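(* Let $\mathbb{E}$ be a separable Banach space and let $\mu \in \mathcal{P}(\mathbb{E})$ be a weakly stable distribution with $\mu \neq \delta_0$. If $\lambda$ is $\mu$-weakly infinitely divisible, then there exists a family $\{\lambda^r : r \geq 0\}$ of probability measures on $\mathbb{R}$ such that (1) $\lambda^0 = \delta_0$ and $\lambda^1 = \lambda$; (2) $\lambda^r \oplus_\mu \lambda^s = \lambda^{r+s}$ for all $r, s \geq 0$; (3) $\lambda^r \Rightarrow \delta_0$ (weak convergence) as $r \to 0$.
   Context: $\mathcal{P}(\mathbb{E})$ is the set of all Borel probability measures on $\mathbb{E}$, $\mathcal{P} = \mathcal{P}(\mathbb{R})$, and $\mathcal{P}_+$ is the set of probability measures on $[0,\infty)$. For $a \in \mathbb{R}$ and a probability measure $\nu$, $T_a\nu$ is the distribution of $aX$ when $X$ has distribution $\nu$ (so $T_0\nu=\delta_0$). For $\mu \in \mathcal{P}(\mathbb{E})$ and $\lambda \in \mathcal{P}$, the scale mixture is $(\mu \circ \lambda)(A) = \int_{\mathbb{R}} T_s\mu(A)\,\lambda(ds)$ for Borel $A \subset \mathbb{E}$, also written $\lambda\circ\mu$; it is the distribution of $\mathbf{X}\Theta$, where $\mathbf{X}\sim\mu$ and $\Theta\sim\lambda$ are independent. The symbol $*$ denotes ordinary convolution. For $\lambda \in \mathcal{P}$, $|\lambda|$ denotes the distribution of $|\Theta|$ when $\Theta \sim \lambda$. A measure $\mu \in \mathcal{P}(\mathbb{E})$ is weakly stable if for all $\lambda_1,\lambda_2 \in \mathcal{P}$ there exists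 $\lambda \in \mathcal{P}$ such that $(\lambda_1\circ\mu)*(\lambda_2\circ\mu)=\lambda\circ\mu$. A measure $\mu$ is symmetric if $T_{-1}\mu=\mu$. If $\mu\ne\delta_0$ is weakly stable and not symmetric, the measure $\lambda$ is uniquely determined; if $\mu\neq\delta_0$ is weakly stable and symmetric, $|\lambda|$ is uniquely determined. Generalized convolution: let $\mu \neq \delta_0$ be weakly stable and $\lambda_1,\lambda_2\in\mathcal{P}$. If $\lambda\in\mathcal{P}$ satisfies $(\lambda_1\circ\mu)*(\lambda_2\circ\mu)=\lambda\circ\mu$, then $\lambda_1\oplus_\mu\lambda_2 := \lambda$ if $\mu$ is not symmetric, and $\lambda_1\oplus_\mu\lambda_2 := |\lambda|$ if $\mu$ is symmetric. This operation is commutative and associative. A probability measure $\lambda$ on $\mathbb{R}$ is $\mu$-weakly infinitely divisible if for every $n\in\mathbb{N}$, $n \ge 1$, there exists a probability measure $\lambda_n$ such that $\lambda=\lambda_n\oplus_\mu\cdots\oplus_\mu\lambda_n$ ($n$ times; for $n=1$ this reads $\lambda=\lambda_1$), where $\lambda_n\in\mathcal{P}_+$ if $\mu$ is symmetric and $\lambda_n\in\mathcal{P}$ if $\mu$ is not symmetric. *)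

(* Defs.v *)
From HB Require Import structures.
From mathcomp Require Import all_boot all_order all_algebra.
From mathcomp Require Import all_classical all_reals all_analysis.

Set Implicit Arguments.
Unset Strict Implicit.
Unset Printing Implicit Defensive.

Import Order.TTheory GRing.Theory Num.Theory.
Import numFieldNormedType.Exports.

Local Open Scope classical_set_scope.
Local Open Scope ring_scope.
Local Open Scope ereal_scope.

Definition separable (T : topologicalType) : Prop :=
  exists2 D : set T, countable D & dense D.

(* Library measures are total functions whose values on non-measurable sets
   carry no information, so equality of measures is agreement on measurable
   sets.  Same relation as the library's [measure_eq], but on bare set functions
   so that it also applies to the formulas below. *)
Definition same_law d (T : measurableType d) (R : realType)
    (m1 m2 : set T -> \bar R) : Prop :=
  forall A, measurable A -> m1 A = m2 A.

Section weak_stability.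
Context (R : realType) (E : completeNormedModType R).

Definition borel := g_sigma_algebraType (@open E).

(* T_a nu *)
Definition rescale (a : R) (nu : set borel -> \bar R) : set borel -> \bar R :=
  pushforward nu (fun x : borel => (a *: (x : E))%R : borel).

(* mu \circ lam *)
Definition mixture (mu : set borel -> \bar R) (lam : set R -> \bar R) :
    set borel -> \bar R :=
  fun A => \int[lam]_s rescale s mu A.

(* [m1 \x m2] lives on the product of the two Borel sigma-algebras; it is the
   Borel sigma-algebra of E * E, and addition is measurable for it, when E is
   separable. *)
Definition convolution (m1 m2 : set borel -> \bar R) : set borel -> \bar R :=
  pushforward (m1 \x m2)
    (fun z : borel * borel => ((z.1 : E) + (z.2 : E))%R : borel).

Definition weakly_stable (mu : probability borel R) : Prop :=
  forall lam1 lam2 : probability R R, exists lam : probability R R,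
    same_law (convolution (mixture mu lam1) (mixture mu lam2))
             (mixture mu lam).

Definition symmetric_law (mu : probability borel R) : Prop :=
  same_law (rescale (- 1) mu) mu.

(* |lam| *)
Definition abs_law (lam : set R -> \bar R) : set R -> \bar R :=
  pushforward lam (fun x : R => `|x|%R).

(* [is_gconv mu lam1 lam2 nu] is the graph of the generalized convolution:
   lam1 \oplus_mu lam2 = nu.  For weakly stable mu other than \d_0 it determines
   nu uniquely, up to [same_law]. *)
Definition is_gconv (mu : probability borel R)
    (lam1 lam2 nu : probability R R) : Prop :=
  exists lam : probability R R,
    [/\ same_law (convolution (mixture mu lam1) (mixture mu lam2))
                 (mixture mu lam),
        ~ symmetric_law mu -> same_law nu lam
      & symmetric_law mu -> same_law nu (abs_law lam)].

(* [gconv_pow mu lam n nu]: nu is the n-fold lam \oplus_mu ... \oplus_mu lam,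
   bracketed to the left; the least possible n is 1. *)
Inductive gconv_pow (mu : probability borel R) (lam : probability R R) :
    nat -> probability R R -> Prop :=
| gconv_pow1 (nu : probability R R) : same_law nu lam -> gconv_pow mu lam 1 nu
| gconv_powS n (nu nu' : probability R R) :
    gconv_pow mu lam n nu -> is_gconv mu nu lam nu' ->
    gconv_pow mu lam n.+1 nu'.

Definition weakly_infinitely_divisible (mu : probability borel R)
    (lam : probability R R) : Prop :=
  forall n : nat, (0 < n)%N -> exists lam_n : probability R R,
    (symmetric_law mu -> lam_n [set x | (0 <= x)%R] = 1) /\
    gconv_pow mu lam_n n lam.

End weak_stability.

Definition weakly_converges (R : realType) (I : Type) (F : set_system I)
    (Lam : I -> probability R R) (nu : set R -> \bar R) : Prop :=
  forall f : R -> R, continuous f -> bounded_fun f ->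
    (\int[Lam i]_x (f x)%:E) @[i --> F] --> \int[nu]_x (f x)%:E.

(* Main.v *)
From HB Require Import structures.
Require Import Defs.
From mathcomp Require Import all_boot all_order all_algebra.
From mathcomp Require Import all_classical all_reals all_analysis.
From mathcomp Require Import measurable_realfun ring lra zify.
Import Order.TTheory GRing.Theory Num.Theory.
Import numFieldNormedType.Exports.

(** Let X have law mu. For every N, let kappa_N be the law of Theta X, where
    Theta, independent of X, is distributed as an N-th root of lam for the
    generalized convolution; thus the N-th convolution power of kappa_N is the
    mixture of mu by lam. By weak stability the k-th convolution power of
    kappa_N is again a mixture of mu, by some pi_N(k) ([root_powers]). The
    measure Lam r is the weak limit of pi_N(floor (r N)) along one ultrafilter
    on the integers N, the same for all r. This choice makes the limits
    coherent for uncountably many r at once: floor ((r + s) N) is equal to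
    floor (r N) + floor (s N) or to that number plus one, mixtures and
    convolutions pass to weak limits ([converges_mix], [converges_convolve]),
    and one additional factor kappa_N disappears in the limit because kappa_N
    tends to the Dirac mass at 0.

    Two facts make this work: the pi_N(k) with k <= C N form a tight family,
    and kappa_N, or more generally pi_N(floor (r N)) for small r, is close to
    the Dirac mass at 0 uniformly in N. In probabilistic terms, let S_k be the
    sum of k independent variables of law kappa_N; the law of S_(C N) does not
    depend on N.

    - Tightness ([conv_pow_tight]). As S_N is the sum of S_(N - k) and of an
      independent copy of S_k, fixing a suitable value of the former yields a
      centre a_k around which S_k is concentrated. The centres are nearly
      additive, because S_(j + k) is distributed as the sum of independent
      copies of S_j and S_k, and a_N is bounded; a nearly additive function on
      0, ..., N that is bounded at N is bounded everywhere
      ([near_additive_bound]).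

    - Infinitesimality ([mixing_infinitesimal]). By an Ottaviani argument, if
      all S_j with j <= n m stay in a ball with probability at least 3/4, then
      a block of m steps leaves a ball with radius four times as large with
      probability at most 1 / n ([conv_pow_block]). But if Theta exceeds eps
      in absolute value with probability c, then with a probability that
      depends only on m, c and mu, all of m steps lie in a narrow cone
      around a fixed vector charged by mu, where norms add up
      ([conv_pow_cone]). For m and then n large these bounds are incompatible.

    Tails of mixtures control tails of mixing measures ([mix_tail]), and tight
    families of laws on the line have limits along ultrafilters, by Helly's
    selection argument ([tight_ultra_converges]). If mu is symmetric, replacing
    a mixing measure by its image under the absolute value does not change the
    mixture ([mix_absl]), so that all mixing measures may be taken on the half
    line. *)

Set Implicit Arguments.
Unset Strict Implicit.
Unset Printing Implicit Defensive.

Local Open Scope classical_set_scope.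
Local Open Scope ring_scope.

(** With indicators as real-valued functions, probabilities of events are means,
    and every estimate takes place in R instead of the extended reals. *)
Local Notation ind b := (GRing.natmul 1 (nat_of_bool b)).

(** * Means of bounded measurable functions *)

Section bounded_measurable.
Context d (T : measurableType d) (R : realType).
Implicit Types (f g : T -> R) (P : probability T R).

Definition bounded_measurable f :=
  measurable_fun setT f /\ exists M, forall x, `|f x| <= M.

Lemma bm_cst (r : R) : bounded_measurable (fun=> r).
Proof. by split; [exact: measurable_cst|exists `|r|]. Qed.

Lemma bmD f g : bounded_measurable f -> bounded_measurable g ->
  bounded_measurable (fun x => f x + g x).
Proof.
move=> [mf [M fM]] [mg [N gN]]; split; first exact: measurable_funD.
by exists (M + N) => x; rewrite (le_trans (ler_normD _ _))// lerD.
Qed.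

Lemma bmM f g : bounded_measurable f -> bounded_measurable g ->
  bounded_measurable (fun x => f x * g x).
Proof.
move=> [mf [M fM]] [mg [N gN]]; split; first exact: measurable_funM.
by exists (M * N) => x; rewrite normrM ler_pM.
Qed.

Lemma bmN f : bounded_measurable f -> bounded_measurable (fun x => - f x).
Proof.
move=> [mf [M fM]]; split; first exact: measurable_funN.
by exists M => x; rewrite normrN.
Qed.

Lemma bmB f g : bounded_measurable f -> bounded_measurable g ->
  bounded_measurable (fun x => f x - g x).
Proof. by move=> bf bg; apply: bmD => //; exact: bmN. Qed.

Lemma bm_norm f : bounded_measurable f -> bounded_measurable (fun x => `|f x|).
Proof.
move=> [mf [M fM]]; split; first exact: measurableT_comp.
by exists M => x; rewrite normr_id.
Qed.

Lemma bm_unit f : measurable_fun setT f -> (forall x, 0 <= f x <= 1) ->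
  bounded_measurable f.
Proof.
move=> mf f01; split=> //; exists 1 => x.
by case/andP: (f01 x) => f0 f1; rewrite ger0_norm.
Qed.

Lemma bm_bool (b : T -> bool) : measurable_fun setT b ->
  bounded_measurable (fun x => (b x)%:R : R).
Proof.
move=> mb; apply: bm_unit; last by move=> x; case: (b x); rewrite ?ler01 lexx ?ler01.
have -> : (fun x => (b x)%:R) = \1_(b @^-1` [set true]) :> (T -> R).
  apply/funext => x; rewrite indicE; congr (_%:R); congr nat_of_bool.
  by apply/idP/idP => [bx|]; [rewrite inE|rewrite inE].
by apply: measurable_indic; rewrite -[X in measurable X]setTI; exact: mb.
Qed.

Lemma bm_integrable P f : bounded_measurable f ->
  P.-integrable setT (EFin \o f).
Proof.
move=> [mf [M fM]]; apply: measurable_bounded_integrable => //.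
- by rewrite -ge0_fin_numE// fin_num_measure.
- by exists M; split => [|N MN x _ /=]; rewrite ?num_real// (le_trans (fM x))// ltW.
Qed.

Lemma mean_cst P (r : R) : \int[P]_x r = r.
Proof.
by rewrite Rintegral_cst// [X in fine X](probability_setT P) mulr1.
Qed.

Lemma meanD P f g : bounded_measurable f -> bounded_measurable g ->
  \int[P]_x (f x + g x) = \int[P]_x f x + \int[P]_x g x.
Proof. by move=> bf bg; rewrite RintegralD//; exact: bm_integrable. Qed.

Lemma meanB P f g : bounded_measurable f -> bounded_measurable g ->
  \int[P]_x (f x - g x) = \int[P]_x f x - \int[P]_x g x.
Proof. by move=> bf bg; rewrite RintegralB//; exact: bm_integrable. Qed.

Lemma meanZ P r f : bounded_measurable f ->
  \int[P]_x (r * f x) = r * \int[P]_x f x.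
Proof. by move=> bf; rewrite RintegralZl//; exact: bm_integrable. Qed.

Lemma le_mean P f g : bounded_measurable f -> bounded_measurable g ->
  (forall x, f x <= g x) -> \int[P]_x f x <= \int[P]_x g x.
Proof. by move=> bf bg fg; apply: le_Rintegral => //; exact: bm_integrable. Qed.

Lemma mean_ge0 P f : (forall x, 0 <= f x) -> 0 <= \int[P]_x f x.
Proof. by move=> f0; apply: Rintegral_ge0. Qed.

Lemma mean_le P f r : bounded_measurable f -> (forall x, f x <= r) ->
  \int[P]_x f x <= r.
Proof. by move=> bf fr; rewrite -[leRHS](mean_cst P) le_mean//; exact: bm_cst. Qed.

Lemma mean_ge P f r : bounded_measurable f -> (forall x, r <= f x) ->
  r <= \int[P]_x f x.
Proof. by move=> bf fr; rewrite -[leLHS](mean_cst P) le_mean//; exact: bm_cst. Qed.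

Lemma norm_mean_le P f g : bounded_measurable f -> bounded_measurable g ->
  (forall x, `|f x| <= g x) -> `|\int[P]_x f x| <= \int[P]_x g x.
Proof.
move=> bf bg fg; rewrite (le_trans (le_normr_Rintegral _ (bm_integrable P bf)))//.
by apply: le_mean => //; exact: bm_norm.
Qed.

Lemma norm_mean P f r : bounded_measurable f -> (forall x, `|f x| <= r) ->
  `|\int[P]_x f x| <= r.
Proof.
by move=> bf fr; rewrite -[leRHS](mean_cst P) norm_mean_le//; exact: bm_cst.
Qed.

(** The probabilistic method: a bound on a mean yields a point at which the
    integrand satisfies it. *)
Lemma mean_lt_ex P f r : bounded_measurable f -> \int[P]_x f x < r ->
  exists x, f x < r.
Proof.
move=> bf fr; apply: contrapT => /forallNP h.
have : r <= \int[P]_x f x.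
  by apply: mean_ge => // x; rewrite leNgt; apply/negP/h.
by rewrite leNgt fr.
Qed.

Lemma mean_indic P (A : set T) : measurable A ->
  \int[P]_x \1_A x = fine (P A).
Proof. by move=> mA; rewrite /Rintegral integral_indic// setIT. Qed.

Lemma mean_boolE P (A : set T) (b : T -> bool) : measurable A ->
  (forall x, b x <-> A x) -> \int[P]_x (b x)%:R = fine (P A).
Proof.
move=> mA bA; rewrite -mean_indic//; apply: eq_Rintegral => x _; rewrite indicE.
by congr (_%:R); congr nat_of_bool; apply/idP/idP; rewrite inE => /bA.
Qed.

Lemma eq_law_mean P (Q : probability T R) f : same_law P Q ->
  \int[P]_x f x = \int[Q]_x f x.
Proof. by move=> PQ; congr fine; apply: eq_measure_integral => A mA _; exact: PQ. Qed.

(** Means of bounded functions determine a law, so identities between laws are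
    proved by computing with iterated means. *)
Lemma same_law_mean P (Q : probability T R) :
  (forall f, bounded_measurable f -> \int[P]_x f x = \int[Q]_x f x) ->
  same_law P Q.
Proof.
move=> h A mA; rewrite -[LHS]fineK ?fin_num_measure// -[RHS]fineK ?fin_num_measure//.
rewrite -!mean_indic// h//; apply: bm_unit; first exact: measurable_indic.
by move=> x; rewrite indicE; case: (x \in A); rewrite ?ler01 lexx ?ler01.
Qed.

Lemma mean_dirac (a : T) f : bounded_measurable f ->
  \int[\d_a]_x f x = f a.
Proof.
move=> [mf _]; rewrite /Rintegral integral_dirac ?diracT ?mul1e//.
exact/measurable_EFinP.
Qed.

End bounded_measurable.

Section same_law.
Context d (T : measurableType d) (R : realType).
Implicit Types m : set T -> \bar R.

Lemma same_law_refl m : same_law m m. Proof. by []. Qed.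

Lemma same_law_sym m1 m2 : same_law m1 m2 -> same_law m2 m1.
Proof. by move=> h A mA; rewrite h. Qed.

Lemma same_law_trans m1 m2 m3 :
  same_law m1 m2 -> same_law m2 m3 -> same_law m1 m3.
Proof. by move=> h h' A mA; rewrite h// h'. Qed.

End same_law.

Lemma bm_comp d1 d2 (T1 : measurableType d1) (T2 : measurableType d2)
    (R : realType) (f : T2 -> R) (phi : T1 -> T2) :
  bounded_measurable f -> measurable_fun setT phi ->
  bounded_measurable (fun x => f (phi x)).
Proof.
move=> [mf [M fM]] mphi; split; last by exists M => x; exact: fM.
exact: measurableT_comp.
Qed.

Section mean_product.
Context d1 d2 (T1 : measurableType d1) (T2 : measurableType d2) (R : realType).
Variables (P : probability T1 R) (Q : probability T2 R).

Lemma mean_pushforward (phi : T1 -> T2) (f : T2 -> R) :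
  measurable_fun setT phi -> bounded_measurable f ->
  fine (\int[pushforward P phi]_x (f x)%:E)%E = \int[P]_x f (phi x).
Proof.
move=> mphi bf; congr fine; rewrite integral_pushforward//.
- by apply/measurable_EFinP; case: bf.
- exact: (@bm_integrable _ _ _ P (fun x => f (phi x)) (bm_comp bf mphi)).
Qed.

Lemma bm_section1 (f : T1 * T2 -> R) (x : T1) : bounded_measurable f ->
  bounded_measurable (fun y => f (x, y)).
Proof. by move=> bf; apply: (@bm_comp _ _ _ _ _ f (pair x)). Qed.

Lemma mean_product (f : T1 * T2 -> R) : bounded_measurable f ->
  bounded_measurable (fun x => \int[Q]_y f (x, y)) /\
  fine (\int[(P \x Q)%E]_z (f z)%:E)%E = \int[P]_x \int[Q]_y f (x, y).
Proof.
move=> bf; have iPQ : ((P \x Q)%E).-integrable setT (EFin \o f).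
  exact: (@bm_integrable _ _ _ ((P \x Q)%E : probability _ _)).
have fE x : (\int[Q]_y f (x, y))%:E = (\int[Q]_y (EFin \o f) (x, y))%E.
  rewrite /Rintegral fineK//; apply: integrable_fin_num => //.
  exact: (@bm_integrable _ _ _ Q (fun y => f (x, y)) (bm_section1 x bf)).
split.
  split.
    apply/measurable_EFinP; rewrite (_ : _ \o _ = fubini_F Q (EFin \o f)).
      exact: (measurable_fubini_F iPQ).
    by apply/funext => x /=; rewrite fE.
  case: (bf) => _ [M fM]; exists M => x; apply: norm_mean => [|y]; last exact: fM.
  exact: bm_section1.
congr fine; rewrite -(integral12_prod_meas1 iPQ).
by apply: eq_integral => x _; rewrite fE.
Qed.

End mean_product.

(** * Borel sets of a separable Banach space *)

Lemma separable_seq (R : realType) (V : normedModType R) : separable V ->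
  exists e : nat -> V, forall (x : V) (r : R), 0 < r ->
    exists n, `|x - e n| < r.
Proof.
move=> [D cD dD]; move: (cD) => /pfcard_geP[D0|[f]].
  have [//| | x []] := dD setT; [by exists 0|exact: openT|].
  by rewrite D0.
exists f => x r r0.
have [||y [xy Dy]] := dD (ball x r); last first.
- have [n _ fn] := @surj _ _ _ _ f y Dy.
  by exists n; rewrite fn; move: xy; rewrite -ball_normE.
- exact: ball_open.
- by exists x; exact: ballxx.
Qed.

(** The product sigma-algebra of two Borel sigma-algebras contains all open sets
    when both spaces are separable: an open set is then a countable union of
    products of balls with centres in dense sequences. The types T1 and T2
    carry the sigma-algebras and V1 and V2 the topologies, because no single
    type carries both for a Banach space. *)
Lemma measurable_borel_pair d1 d2 (T1 : measurableType d1)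
    (T2 : measurableType d2) (R : realType) (V1 V2 : normedModType R)
    (V : completeNormedModType R) (i1 : T1 -> V1) (i2 : T2 -> V2)
    (phi : V1 * V2 -> V) :
  separable V1 -> separable V2 ->
  (forall U, open U -> measurable (i1 @^-1` U)) ->
  (forall U, open U -> measurable (i2 @^-1` U)) ->
  continuous phi ->
  measurable_fun setT ((fun z => phi (i1 z.1, i2 z.2)) : T1 * T2 -> borel V).
Proof.
move=> /separable_seq[e1 e1P] /separable_seq[e2 e2P] m1 m2 cphi.
apply: (@measurability _ _ _ (borel V) _ _ (@open V)) => // _ [U oU <-].
rewrite setTI.
have oW : open (phi @^-1` U) by move/continuousP : cphi; exact.
pose B (p : nat * nat * nat) : set (V1 * V2) :=
  ball (e1 p.1.1) (p.2.+1%:R^-1) `*` ball (e2 p.1.2) (p.2.+1%:R^-1).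
pose F p : set (T1 * T2) :=
  [set z | B p `<=` phi @^-1` U /\ B p (i1 z.1, i2 z.2)].
rewrite (_ : _ @^-1` _ = \bigcup_p F p); last first.
  apply/seteqP; split => [[t1 t2] /= Ut|[t1 t2] [p _ [BU]]]; last exact: BU.
  have : nbhs (i1 t1, i2 t2) (phi @^-1` U) by apply: open_nbhs_nbhs; split.
  move=> /nbhs_ballP[r /= r0 rU].
  have [n nr] : exists n, n.+1%:R^-1 < r / 2 :> R.
    have r20 : 0 < r / 2 by rewrite divr_gt0.
    exists (Num.truncn (r / 2)^-1).
    rewrite -[ltRHS]invrK ltf_pV2 ?posrE ?invr_gt0//.
    by rewrite truncnS_gt.
  have n0 : 0 < n.+1%:R^-1 :> R by rewrite invr_gt0.
  have [a ha] := e1P (i1 t1) _ n0.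
  have [b hb] := e2P (i2 t2) _ n0.
  have tri (W : normedModType R) (x y z : W) :
      ball y n.+1%:R^-1 z -> `|x - y| < n.+1%:R^-1 -> ball x r z.
    rewrite -!ball_normE /= => yz xy.
    rewrite -(subrK y x) -addrA (le_lt_trans (ler_normD _ _))//.
    by rewrite [ltRHS]splitr ltrD// (lt_trans _ nr).
  exists (a, b, n) => //; split; last first.
    split => /=; first by rewrite -(@ball_normE _ V1) /= distrC.
    by rewrite -(@ball_normE _ V2) /= distrC.
  case=> [u v] [/= hu hv]; apply: rU; split.
    exact: (tri _ _ _ _ hu ha).
  exact: (tri _ _ _ _ hv hb).
apply: countable_bigcupT_measurable; first exact: countableP.
move=> p; have [BU|BU] := pselect (B p `<=` phi @^-1` U); last first.
  by rewrite (_ : F p = set0)// -subset0 => z [].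
rewrite (_ : F p = (i1 @^-1` ball (e1 p.1.1) (p.2.+1%:R^-1)) `*`
                   (i2 @^-1` ball (e2 p.1.2) (p.2.+1%:R^-1))).
  by apply: measurableX; [apply: m1|apply: m2]; exact: ball_open.
by apply/seteqP; split => z // [].
Qed.

Section borel.
Context (R : realType) (E : completeNormedModType R).

Lemma open_measurable_borel (U : set (borel E)) : @open E U -> measurable U.
Proof. by move=> oU; exact: sub_sigma_algebra. Qed.

Lemma measurable_borel_continuous (f : E -> R) : continuous f ->
  measurable_fun setT (f : borel E -> R).
Proof.
move=> /continuousP cf; apply: (measurability _ (RGenOpens.measurableE R)).
move=> _ [_ [a [b ->]] <-]; rewrite setTI; apply: open_measurable_borel.
by apply: cf; exact: interval_open.
Qed.

Hypothesis sepE : separable E.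

Lemma measurable_borelD :
  measurable_fun setT ((fun z => (z.1 : E) + (z.2 : E)) :
    borel E * borel E -> borel E).
Proof.
apply: (@measurable_borel_pair _ _ (borel E) (borel E) _ E E E idfun idfun
  (fun z => z.1 + z.2)) => //; try exact: open_measurable_borel.
exact: add_continuous.
Qed.

Lemma separable_real : separable R^o.
Proof.
exists (range (@ratr R)); 
  first exact: (sub_countable (card_image_le _ _) (countableP _)).
exact: dense_rat.
Qed.

Lemma measurable_borelZ :
  measurable_fun setT ((fun z => z.1 *: (z.2 : E)) : R * borel E -> borel E).
Proof.
apply: (@measurable_borel_pair _ _ R (borel E) _ R^o E E idfun idfun
  (fun z => z.1 *: z.2)) => //.
- exact: separable_real.
- exact: open_measurable.
- exact: open_measurable_borel.
- exact: scale_continuous.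
Qed.

End borel.

(** * Convolutions and scale mixtures as probability measures *)

Section image_law.
Context d1 d2 (T1 : measurableType d1) (T2 : measurableType d2) (R : realType).

Definition image_law (P : probability T1 R) (phi : T1 -> T2)
    (mphi : measurable_fun setT phi) : probability T2 R :=
  distribution P (mfun_Sub (mem_set mphi) : {mfun T1 >-> T2}).

Lemma mean_image_law P phi (mphi : measurable_fun setT phi) (f : T2 -> R) :
  bounded_measurable f ->
  \int[image_law P mphi]_x f x = \int[P]_x f (phi x).
Proof. exact: (@mean_pushforward _ _ _ _ _ P phi). Qed.

End image_law.

Section conv_mix.
Context (R : realType) (E : completeNormedModType R).
Hypothesis sepE : separable E.
Variable mu : probability (borel E) R.
Implicit Types (P Q : probability (borel E) R) (lam : probability R R).

Definition convolve P Q : probability (borel E) R :=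
  image_law ((P \x Q)%E : probability _ _) (measurable_borelD sepE).

Definition mix lam : probability (borel E) R :=
  image_law ((lam \x mu)%E : probability _ _) (measurable_borelZ sepE).

Lemma convE P Q : convolve P Q = convolution P Q :> (set (borel E) -> \bar R).
Proof. by []. Qed.

(** The two sides agree on all sets, measurable or not, so that the mixtures in
    the definition of the generalized convolution can be rewritten. *)
Lemma mixE lam : mixture mu lam = mix lam :> (set (borel E) -> \bar R).
Proof.
apply/funext => A; apply: eq_integral => s _.
rewrite /rescale /pushforward /=; congr (mu _).
by apply/seteqP; split => x /=; rewrite /xsection /= inE.
Qed.

Lemma bm_convr P (f : E -> R) : bounded_measurable (f : borel E -> R) ->
  bounded_measurable ((fun x => \int[P]_y f (x + (y : E))) : borel E -> R).
Proof.
move=> bf; have bF : bounded_measurable ((fun z => f ((z.1 : E) + (z.2 : E)))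
    : borel E * borel E -> R).
  by apply: (@bm_comp _ _ _ _ _ (f : borel E -> R) _ bf);
    exact: (measurable_borelD sepE).
by have [] := mean_product P P bF.
Qed.

Lemma mean_conv P Q (f : E -> R) : bounded_measurable (f : borel E -> R) ->
  \int[convolve P Q]_z f z = \int[P]_x \int[Q]_y f ((x : E) + (y : E)).
Proof.
move=> bf; rewrite mean_image_law//.
have bF : bounded_measurable ((fun z => f ((z.1 : E) + (z.2 : E)))
    : borel E * borel E -> R).
  by apply: (@bm_comp _ _ _ _ _ (f : borel E -> R) _ bf);
    exact: (measurable_borelD sepE).
by have [_ <-] := mean_product P Q bF.
Qed.

Lemma bm_scale (f : E -> R) : bounded_measurable (f : borel E -> R) ->
  bounded_measurable ((fun s => \int[mu]_x f (s *: (x : E))) : R -> R).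
Proof.
move=> bf; have bF : bounded_measurable ((fun z => f (z.1 *: (z.2 : E)))
    : R * borel E -> R).
  by apply: (@bm_comp _ _ _ _ _ (f : borel E -> R) _ bf);
    exact: (measurable_borelZ sepE).
by have [] := mean_product (\d_(0 : R)) mu bF.
Qed.

Lemma mean_mix lam (f : E -> R) : bounded_measurable (f : borel E -> R) ->
  \int[mix lam]_z f z = \int[lam]_s \int[mu]_x f (s *: (x : E)).
Proof.
move=> bf; rewrite mean_image_law//.
have bF : bounded_measurable ((fun z => f (z.1 *: (z.2 : E)))
    : R * borel E -> R).
  by apply: (@bm_comp _ _ _ _ _ (f : borel E -> R) _ bf);
    exact: (measurable_borelZ sepE).
by have [_ <-] := mean_product lam mu bF.
Qed.

Lemma bm_shift (f : E -> R) (a : E) : bounded_measurable (f : borel E -> R) ->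
  bounded_measurable ((fun y => f (a + (y : E))) : borel E -> R).
Proof.
move=> bf; apply: (@bm_comp _ _ (borel E) (borel E) R f
  (fun y => a + (y : E)) bf).
have h := measurableT_comp (measurable_borelD sepE)
  (@pair1_measurable _ _ (borel E) (borel E) (a : borel E)).
exact h.
Qed.

Lemma bm_homothety (f : E -> R) (s : R) :
  bounded_measurable (f : borel E -> R) ->
  bounded_measurable ((fun y => f (s *: (y : E))) : borel E -> R).
Proof.
move=> bf; apply: (@bm_comp _ _ (borel E) (borel E) R f
  (fun y => s *: (y : E)) bf).
have h := measurableT_comp (measurable_borelZ sepE)
  (@pair1_measurable _ _ R (borel E) (s : R)).
exact h.
Qed.

Lemma conv_law P P' Q Q' : same_law P P' -> same_law Q Q' ->
  same_law (convolve P Q) (convolve P' Q').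
Proof.
move=> PP QQ; apply: same_law_mean => f bf; rewrite !mean_conv// (eq_law_mean _ PP).
by apply: eq_Rintegral => x _; exact: eq_law_mean.
Qed.

Lemma mix_law lam lam' : same_law lam lam' -> same_law (mix lam) (mix lam').
Proof.
by move=> ll; apply: same_law_mean => f bf; rewrite !mean_mix// (eq_law_mean _ ll).
Qed.

Lemma convA P Q P' : same_law (convolve P (convolve Q P')) (convolve (convolve P Q) P').
Proof.
apply: same_law_mean => f bf; rewrite !mean_conv//; last exact: bm_convr.
apply: eq_Rintegral => x _; rewrite mean_conv//; last exact: bm_shift.
apply: eq_Rintegral => y _; apply: eq_Rintegral => z _.
by rewrite addrA.
Qed.

Definition zero_law : probability (borel E) R := \d_((0 : E) : borel E).

Lemma conv0l P : same_law (convolve zero_law P) P.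
Proof.
apply: same_law_mean => f bf; rewrite mean_conv// mean_dirac.
  by apply: eq_Rintegral => x _; rewrite add0r.
exact: bm_convr.
Qed.

Lemma conv0r P : same_law (convolve P zero_law) P.
Proof.
apply: same_law_mean => f bf; rewrite mean_conv//.
apply: eq_Rintegral => x _; rewrite mean_dirac ?addr0//.
exact: bm_shift.
Qed.

Lemma mix_dirac0 : same_law (mix \d_(0 : R)) zero_law.
Proof.
apply: same_law_mean => f bf; rewrite mean_mix// !mean_dirac//; last exact: bm_scale.
under eq_Rintegral do rewrite scale0r.
by rewrite mean_cst.
Qed.

(** The new factor is on the left, so that inductions on n condition on the
    first step of a random walk. *)
Fixpoint conv_pow P n : probability (borel E) R :=
  if n is k.+1 then convolve P (conv_pow P k) else zero_law.

Lemma conv_pow1 P : same_law (conv_pow P 1) P.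
Proof. exact: conv0r. Qed.

Lemma conv_pow_law P Q n : same_law P Q -> same_law (conv_pow P n) (conv_pow Q n).
Proof. by move=> PQ; elim: n => // n IH; exact: conv_law. Qed.

Lemma conv_powD P m n :
  same_law (conv_pow P (m + n)) (convolve (conv_pow P m) (conv_pow P n)).
Proof.
elim: m => [|m IH]; first by apply: same_law_sym; exact: conv0l.
rewrite addSn /=; apply: same_law_trans (convA _ _ _).
by apply: conv_law => //; exact: same_law_refl.
Qed.

Lemma conv_powM P m n :
  same_law (conv_pow P (n * m)) (conv_pow (conv_pow P m) n).
Proof.
elim: n => [|n IH]; first by rewrite mul0n; exact: same_law_refl.
rewrite mulSn /=; apply: same_law_trans (conv_powD _ _ _) _.
by apply: conv_law => //; exact: same_law_refl.
Qed.

End conv_mix.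

(** * Tails of convolution powers *)

Section tails.
Context (R : realType) (E : completeNormedModType R).

Lemma measurable_borel_norm (f : E -> E) : continuous f ->
  measurable_fun setT ((fun x => `|f x|) : borel E -> R).
Proof.
move=> cf; apply: (@measurable_borel_continuous _ E (fun x => `|f x|)) => x.
by apply: continuous_comp; [exact: cf|exact: norm_continuous].
Qed.

Lemma bm_norm_gt (f : E -> E) (t : R) : continuous f ->
  bounded_measurable ((fun x => ind (t < `|f x|) : R) : borel E -> R).
Proof.
move=> cf; apply: bm_bool; apply: measurable_fun_ltr => //.
exact: measurable_borel_norm.
Qed.

Lemma bm_norm_le (f : E -> E) (t : R) : continuous f ->
  bounded_measurable ((fun x => ind (`|f x| <= t) : R) : borel E -> R).
Proof.
move=> cf; apply: bm_bool; apply: measurable_fun_ler => //.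
exact: measurable_borel_norm.
Qed.

Lemma continuous_addl (a : E) : continuous (fun x : E => a + x).
Proof. by move=> x; apply: cvgD; [exact: cvg_cst|exact: cvg_id]. Qed.

Lemma continuous_subr (a : E) : continuous (fun x : E => x - a).
Proof. by move=> x; apply: cvgB; [exact: cvg_id|exact: cvg_cst]. Qed.

Lemma bm_norm_gt_id (t : R) :
  bounded_measurable ((fun x : E => ind (t < `|x|) : R) : borel E -> R).
Proof. by apply: (@bm_norm_gt idfun) => x; exact: cvg_id. Qed.

(** Let M be the maximum of the norms of the a k. If k <= N / 2, comparing
    a (k + k) with a k + a k gives norm (a k) <= (M + c) / 2; the other k are
    treated through N - k. Hence M <= (3 c) / 2 + c' + M / 2. *)
Lemma near_additive_bound (N : nat) (a : nat -> E) (c c' : R) :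
  (forall j k, (j + k <= N)%N -> `|a (j + k)%N - a j - a k| <= c) ->
  `|a N| <= c' -> forall k, (k <= N)%N -> `|a k| <= 3 * c + 2 * c'.
Proof.
move=> add aN.
pose M := \big[Num.max/0]_(k < N.+1) `|a k|.
have aM k : (k <= N)%N -> `|a k| <= M.
  by move=> kN; apply: (le_bigmax _ (fun k : 'I__ => `|a k|)
    (Ordinal (kN : (k < N.+1)%N))).
have c0 : 0 <= c by apply: le_trans (add 0%N 0%N _); rewrite ?normr_ge0.
have c'0 : 0 <= c' by apply: le_trans aN; rewrite normr_ge0.
have M0 : 0 <= M by apply: le_trans (aM 0%N _).
have half k : (k + k <= N)%N -> `|a k| <= (M + c) / 2.
  move=> kN; have := add _ _ kN; have := aM _ kN => h1 h2.
  have : `|a k + a k| <= M + c.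
    rewrite (_ : a k + a k = a (k + k)%N - (a (k + k)%N - a k - a k)).
      by rewrite (le_trans (ler_normB _ _))// lerD.
    by rewrite -(addrA _ (- a k)) -opprD subKr.
  rewrite -mulr2n normrMn -mulr_natr => h; lra.
have bnd k : (k <= N)%N -> `|a k| <= c + c' + (M + c) / 2.
  move=> kN; have [h|h] := leqP (k + k) N.
    by have := half _ h; lra.
  have hk : (N - k + (N - k) <= N)%N by lia.
  have hN : (k + (N - k) <= N)%N by lia.
  have := add _ _ hN; rewrite subnKC// => hc.
  have := half _ hk => hh.
  rewrite (_ : a k = a N - (a N - a k - a (N - k)%N) - a (N - k)%N).
    rewrite (le_trans (ler_normB _ _))// (le_trans (lerD (ler_normB _ _) (lexx _)))//.
    by lra.
  by rewrite -(addrA (a N) (- a k)) -opprD subKr addrK.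
move=> k kN; have : M <= c + c' + (M + c) / 2.
  apply: bigmax_le; last by move=> i _; apply: bnd; rewrite -ltnS.
  by lra.
have := aM _ kN; lra.
Qed.

Hypothesis sepE : separable E.
Implicit Types (P Q : probability (borel E) R).
Local Notation convolve := (convolve sepE).
Local Notation conv_pow := (conv_pow sepE).

(** Some value of the first summand has a conditional tail at most equal to the
    average one; the centre is the opposite of that value. *)
Lemma center_exists P Q (t eta : R) :
  \int[convolve P Q]_z ind (t < `|z : E|) < eta ->
  exists a : E, \int[Q]_y ind (t < `|(y : E) - a|) < eta.
Proof.
rewrite mean_conv; last exact: bm_norm_gt_id.
move=> /mean_lt_ex[|x]; first exact: (bm_convr sepE _ (bm_norm_gt_id t)).
move=> h; exists (- (x : E)).
by under eq_Rintegral do rewrite opprK addrC.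
Qed.

(** As 3 * (1 / 4) < 1, some pair (x, y) satisfies at once that x is close to a,
    y is close to b and x + y is close to c. *)
Lemma centers_additive P Q (a b c : E) (t : R) :
  \int[P]_x ind (t < `|(x : E) - a|) < 4^-1 ->
  \int[Q]_x ind (t < `|(x : E) - b|) < 4^-1 ->
  \int[convolve P Q]_x ind (t < `|(x : E) - c|) < 4^-1 ->
  `|c - a - b| <= 3 * t.
Proof.
move=> hP hQ; rewrite mean_conv; last first.
  exact: (bm_norm_gt t (@continuous_subr c)).
move=> hPQ.
have bP := bm_norm_gt t (@continuous_subr a).
have bQ := bm_norm_gt t (@continuous_subr b).
have bPQ := bm_convr sepE Q (bm_norm_gt t (@continuous_subr c)).
have := ltrD (ltrD hP hPQ) hQ.
rewrite -meanD// => h.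
have [|x] := @mean_lt_ex _ _ _ P (fun x : borel E => ind (t < `|(x : E) - a|) +
  \int[Q]_y ind (t < `|(x : E) + (y : E) - c|)) (3 / 4 -
  \int[Q]_y ind (t < `|(y : E) - b|)) (bmD bP bPQ); first lra.
move=> hx; have bx : bounded_measurable ((fun y => ind (t < `|(x : E) + (y : E) - c|) : R)
    : borel E -> R).
  apply: (@bm_norm_gt (fun y => (x : E) + y - c)) => y.
  by apply: cvgB; [exact: continuous_addl|exact: cvg_cst].
have : \int[Q]_y (ind (t < `|(y : E) - b|) + ind (t < `|(x : E) + (y : E) - c|))
    < 3 / 4 - ind (t < `|(x : E) - a|).
  by rewrite meanD//; lra.
move=> /mean_lt_ex[|y]; first exact: bmD.
have [xa|xa] := ltP t `|(x : E) - a|; have [yb|yb] := ltP t `|(y : E) - b|;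
  have [xyc|xyc] := ltP t `|(x : E) + (y : E) - c|; rewrite /= => hxy; try lra.
rewrite (_ : c - a - b = ((x : E) - a) + ((y : E) - b) - ((x : E) + (y : E) - c)).
  rewrite (le_trans (ler_normB _ _))//.
  by rewrite (le_trans (lerD (ler_normD _ _) (lexx _)))//; lra.
by rewrite addrACA -opprD opprB [RHS]addrC subrKA opprD addrA.
Qed.

(** Near-additivity of the centres holds with constant 3 t, and the centre of the
    N-th power is bounded by 2 t, so all centres are bounded by
    3 * (3 t) + 2 * (2 t) = 13 t. *)
Lemma conv_pow_tight P (N : nat) (t eta : R) : eta <= 4^-1 ->
  \int[conv_pow P N]_z ind (t < `|z : E|) < eta ->
  forall k, (k <= N)%N -> \int[conv_pow P k]_z ind (14 * t < `|z : E|) < eta.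
Proof.
move=> eta4 hN.
have /choice[a aP] : forall k, exists a : E, (k <= N)%N ->
    \int[conv_pow P k]_z ind (t < `|(z : E) - a|) < eta.
  move=> k; have [kN|kN] := leqP k N; last by exists 0.
  have [a ha] : exists a : E, \int[conv_pow P k]_z ind (t < `|(z : E) - a|) < eta.
    apply: (@center_exists (conv_pow P (N - k))).
    by rewrite -(eq_law_mean _ (conv_powD sepE P (N - k) k)) subnK.
  by exists a.
have aN : `|a N| <= 2 * t.
  have haN := aP _ (leqnn N).
  have bN := bm_norm_gt t (@continuous_subr (a N)).
  have := ltrD haN hN; rewrite -meanD//; last exact: bm_norm_gt_id.
  move=> /mean_lt_ex[|x]; first by apply: bmD => //; exact: bm_norm_gt_id.
  have [xa|xa] := ltP t `|(x : E) - a N|; have [yb|yb] := ltP t `|x : E|;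
    rewrite /= => hxy; try lra.
  rewrite (_ : a N = (x : E) - ((x : E) - a N)); last by rewrite subKr.
  by rewrite (le_trans (ler_normB _ _))//; lra.
have add j k : (j + k <= N)%N -> `|a (j + k)%N - a j - a k| <= 3 * t.
  move=> jkN; apply: (@centers_additive (conv_pow P j) (conv_pow P k)).
  - by apply: lt_le_trans eta4; apply: aP; lia.
  - by apply: lt_le_trans eta4; apply: aP; lia.
  - rewrite -(eq_law_mean _ (conv_powD sepE P j k)).
    by apply: lt_le_trans eta4; apply: aP; lia.
have bnd := near_additive_bound add aN.
move=> k kN; apply: le_lt_trans (aP _ kN).
apply: le_mean; first exact: bm_norm_gt_id.
  exact: (bm_norm_gt t (@continuous_subr (a k))).
move=> z; rewrite ler_nat; case: (ltP (14 * t)) => // hz.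
suff -> : t < `|(z : E) - a k| by [].
have := bnd _ kN; have := ler_normD ((z : E) - a k) (a k); rewrite subrK; lra.
Qed.

(** Ottaviani's inequality in an inductive form. Let p be the probability that
    a step exceeds 4 t. A walk started in the ball of radius 2 t leaves it with
    probability at least p at each step; once outside, it is back in the ball of
    radius t after the remaining steps with probability at most 1 / 4. So the
    probability to be in the ball of radius t after n steps is at most
    1 / 4 + (1 - p) ^ n, while by assumption it is at least 3 / 4. *)
Lemma conv_pow_block P (t : R) (n : nat) : 0 <= t ->
  (forall j, (j <= n)%N -> \int[conv_pow P j]_z ind (t < `|z : E|) <= 4^-1) ->
  n%:R * \int[P]_z ind (4 * t < `|z : E|) <= 1.
Proof.
move=> t0 htail; set p := \int[P]_z _.
have p0 : 0 <= p by apply: mean_ge0 => x; rewrite ler0n.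
have p1 : p <= 1.
  by apply: mean_le; [exact: bm_norm_gt_id|move=> x; rewrite lern1 leq_b1].
have key j : (j <= n)%N -> forall z : E, `|z| <= 2 * t ->
    \int[conv_pow P j]_y ind (`|z + (y : E)| <= t) <= 4^-1 + (1 - p) ^+ j.
  elim: j => [|j IH] jn z zt.
    apply: mean_le => [|x]; first exact: (bm_norm_le t (@continuous_addl z)).
    by rewrite expr0; case: (leP _ t) => _ /=; lra.
  rewrite /= mean_conv; last exact: (bm_norm_le t (@continuous_addl z)).
  have bz := bm_norm_le (2 * t) (@continuous_addl z).
  apply: (@le_trans _ _ (\int[P]_x (4^-1 +
      (1 - p) ^+ j * ind (`|z + (x : E)| <= 2 * t)))).
    apply: le_mean; first exact: (bm_convr sepE _ (bm_norm_le t (@continuous_addl z))).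
      by apply: bmD; [exact: bm_cst|apply: bmM => //; exact: bm_cst].
    move=> x; under eq_Rintegral do rewrite addrA.
    have [zx|zx] := leP `|z + (x : E)| (2 * t).
      by rewrite /= mulr1; apply: IH => //; exact: ltnW.
    rewrite mulr0 addr0; apply: le_trans (htail j (ltnW jn)).
    apply: le_mean; first exact: (bm_norm_le t (@continuous_addl _)).
      exact: bm_norm_gt_id.
    move=> y; rewrite ler_nat; have [zxy|//] := leP `|z + (x : E) + (y : E)| t.
    have [//|yt] := ltP t `|y : E|.
    have := ler_normB (z + (x : E) + (y : E)) (y : E); rewrite addrK; lra.
  rewrite meanD ?mean_cst ?meanZ//; last 2 first.
    exact: bm_cst.
    by apply: bmM => //; exact: bm_cst.
  rewrite lerD2l exprSr ler_wpM2l ?exprn_ge0 ?subr_ge0//.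
  rewrite -[X in _ <= X - _](mean_cst P) -meanB; last 2 first.
    exact: bm_cst.
    exact: bm_norm_gt_id.
  apply: le_mean => //.
    by apply: bmB; [exact: bm_cst|exact: bm_norm_gt_id].
  move=> x; have [zx|zx] := leP `|z + (x : E)| (2 * t);
    have [xt|xt] := ltP (4 * t) `|x : E|; rewrite /=; try lra.
  have := ler_normB (z + (x : E)) z; rewrite addrAC subrr add0r; lra.
have := key n (leqnn n) 0; rewrite normr0 => /(_ ltac:(lra)).
under eq_Rintegral do rewrite add0r.
have := htail n (leqnn n).
have : \int[conv_pow P n]_z ind (`|z : E| <= t) =
    1 - \int[conv_pow P n]_z ind (t < `|z : E|).
  rewrite -[X in _ = X - _](mean_cst (conv_pow P n)) -meanB; last 2 first.
    exact: bm_cst.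
    exact: bm_norm_gt_id.
  by apply: eq_Rintegral => x _; case: leP => _; rewrite /= ?subrr ?subr0.
move=> -> h1 h2.
have pn : 2^-1 <= (1 - p) ^+ n by lra.
(* Bernoulli's inequality turns 1 / 2 <= (1 - p) ^ n into n p <= 1. *)
have bern k : (1 + k%:R * p) * (1 - p) ^+ k <= 1.
  elim: k => [|k IH]; first by rewrite mul0r addr0 mul1r expr0.
  apply: le_trans IH; rewrite exprS mulrA ler_wpM2r ?exprn_ge0 ?subr_ge0//.
  have k0 : 0 <= k%:R :> R by [].
  rewrite -addn1 natrD; nra.
have := bern n.
have np : 0 <= n%:R * p by rewrite mulr_ge0.
nra.
Qed.

End tails.

(** * From tails of mixtures to tails of mixing measures *)

Section mixing_tails.
Context (R : realType) (E : completeNormedModType R).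
Hypothesis sepE : separable E.
Variable mu : probability (borel E) R.
Local Notation convolve := (convolve sepE).
Local Notation conv_pow := (conv_pow sepE).
Local Notation mix := (mix sepE mu).

(** Otherwise the ball of radius norm (e n) / 2 around each nonzero term of a
    dense sequence e is negligible, and these balls cover the complement of the
    origin. *)
Lemma charged_ball :
  ~ same_law mu (\d_((0 : E) : borel E) : set (borel E) -> \bar R) ->
  exists z : E, z != 0 /\ 0 < \int[mu]_x ind (`|(x : E) - z| <= `|z| / 2) :> R.
Proof.
move=> mu0; apply: contrapT => /forallNP noball; apply: mu0.
have [e eP] := separable_seq sepE.
pose B n : set (borel E) := [set x | e n != 0 /\ `|(x : E) - e n| <= `|e n| / 2].
have mB n : measurable [set x : borel E | `|(x : E) - e n| <= `|e n| / 2].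
  rewrite -[X in measurable X]setTI.
  apply: (@measurable_fun_ler _ _ _ setT (fun x : borel E => `|(x : E) - e n|)) => //.
  exact: (measurable_borel_norm (@continuous_subr _ _ (e n))).
have B0 n : mu.-negligible (B n).
  have [en0|en0] := eqVneq (e n) 0.
    rewrite (_ : B n = set0); first exact: negligible_set0.
    by rewrite -subset0 => x []; rewrite en0 eqxx.
  exists [set x | `|(x : E) - e n| <= `|e n| / 2]; split => //; last by move=> x [].
  apply/eqP; rewrite -[X in X == _]fineK ?fin_num_measure//.
  rewrite -(@mean_boolE _ _ _ mu _ (fun x : borel E => `|(x : E) - e n| <= `|e n| / 2))//.
  rewrite eqe eq_le mean_ge0 ?andbT; last by move=> x; rewrite ler0n.
  by rewrite leNgt; apply/negP => h; apply: (noball (e n)).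
have N0 : mu.-negligible [set x : borel E | (x : E) != 0].
  apply: negligibleS (negligible_bigcup B0) => x /= x0.
  have r0 : 0 < `|x : E| / 4 by rewrite divr_gt0 ?normr_gt0.
  have [n xn] := eP (x : E) _ r0; exists n => //.
  have := ler_normD ((x : E) - e n) (e n); rewrite subrK => h.
  have x1 : 0 < `|x : E| by rewrite normr_gt0.
  by split; [rewrite -normr_gt0; lra|lra].
move=> A mA; have [A0|A0] := pselect (A (0 : E)); last first.
  rewrite diracE memNset//.
  apply: (measure_negligible mA); apply: negligibleS N0 => x Ax.
  by apply/eqP => x0; apply: A0; rewrite -x0.
rewrite diracE mem_set//= -[A]setCK probability_setC; last exact: measurableC.
rewrite (_ : mu (~` A) = 0%E) ?sube0//.
apply: (measure_negligible (measurableC mA)); apply: negligibleS N0 => x Ax.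
by apply/eqP => x0; apply: Ax; rewrite x0.
Qed.

Variable z : E.
Hypothesis z0 : z != 0.
Local Notation p := (\int[mu]_x ind (`|(x : E) - z| <= `|z| / 2) : R).
Hypothesis p0 : 0 < p.

Let bm_ball : bounded_measurable
  ((fun x => ind (`|x - z| <= `|z| / 2) : R) : borel E -> R).
Proof. exact: bm_norm_le (@continuous_subr _ _ z). Qed.

Lemma bm_norm_gtR (T : R) : bounded_measurable (fun s : R => ind (T < `|s|) : R).
Proof. by apply: bm_bool; apply: measurable_fun_ltr => //; exact: measurable_normr. Qed.

(** If the scale exceeds T and the mixed vector falls in the charged ball, where
    norms are at least norm z / 2, the product exceeds T * (norm z / 2). *)
Lemma mix_tail (lam : probability R R) (T : R) : 0 <= T ->
  p * \int[lam]_s ind (T < `|s|)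
    <= \int[mix lam]_x ind (T * (`|z| / 2) < `|x : E|).
Proof.
move=> T0; rewrite mean_mix; last exact: bm_norm_gt_id.
rewrite -meanZ; last exact: bm_norm_gtR.
apply: le_mean.
- by apply: bmM; [exact: bm_cst|exact: bm_norm_gtR].
- exact: (bm_scale sepE mu (@bm_norm_gt_id R E (T * (`|z| / 2)))).
move=> s; rewrite mulrC -meanZ//; apply: le_mean.
- by apply: bmM => //; exact: bm_cst.
- exact: (bm_homothety sepE s (@bm_norm_gt_id R E (T * (`|z| / 2)))).
move=> x; have [sT|sT] := ltP T `|s|; last by rewrite mul0r ler0n.
have [xz|xz] := leP `|(x : E) - z| (`|z| / 2); last by rewrite mulr0 ler0n.
rewrite mul1r ler_nat normrZ.
have z1 : 0 < `|z| by rewrite normr_gt0.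
have zx : `|z| / 2 <= `|x : E|.
  have := ler_normB (x : E) ((x : E) - z); rewrite subKr; lra.
suff -> : T * (`|z| / 2) < `|s| * `|x : E| by [].
rewrite (@lt_le_trans _ _ (`|s| * (`|z| / 2)))//; first by rewrite ltr_pM2r//; lra.
by rewrite ler_wpM2l.
Qed.

(** The vectors within w * (norm z / 2) of w sigma z, for some w >= k eps, form
    a set C_k, and C_j + C_k is contained in C_(j + k). A step is in C_1 as soon
    as the signed scale exceeds eps and the mixed vector is in the charged ball,
    two independent events. The sets C_k enter only through the functions that
    are at least 1 on them, which avoids proving that they are measurable. *)
Lemma conv_pow_cone (lam : probability R R) (eps sigma : R) (m : nat)
    (f : E -> R) : 0 < eps -> sigma * sigma = 1 ->
  bounded_measurable (f : borel E -> R) -> (forall y, 0 <= f y) ->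
  (forall y w, m%:R * eps <= w -> `|y - w *: (sigma *: z)| <= w * (`|z| / 2) ->
    1 <= f y) ->
  (p * \int[lam]_s ind (eps < sigma * s)) ^+ m
    <= \int[conv_pow (mix lam) m]_y f y.
Proof.
move=> eps0 ss; set q := p * _.
have bs : bounded_measurable (fun s : R => ind (eps < sigma * s) : R).
  by apply: bm_bool; apply: measurable_fun_ltr => //; exact: measurable_funM.
have q0 : 0 <= q.
  by rewrite mulr_ge0 ?(ltW p0)//; apply: mean_ge0 => s; rewrite ler0n.
have s1 : `|sigma| = 1.
  by apply/eqP; rewrite -sqrp_eq1// -normrX expr2 ss normr1.
elim: m f => [|m IH] f bf f0 fP.
  rewrite expr0 /= mean_dirac//; apply: (fP 0 0); rewrite ?mul0r//.
  by rewrite scale0r subrr normr0.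
have bg : bounded_measurable ((fun x => \int[conv_pow (mix lam) m]_y f (x + (y : E)))
    : borel E -> R) by exact: bm_convr.
rewrite /= mean_conv// mean_mix// exprSr mulrCA -meanZ//.
rewrite -meanZ; last by apply: bmM => //; exact: bm_cst.
apply: le_mean.
- by do 2 (apply: bmM; first exact: bm_cst).
- exact: (bm_scale sepE mu bg).
move=> s; rewrite mulrC -meanZ//; apply: le_mean.
- by apply: bmM => //; exact: bm_cst.
- exact: (bm_homothety sepE s bg).
move=> x /=.
have g0 : 0 <= \int[conv_pow (mix lam) m]_y f (s *: (x : E) + (y : E)).
  exact: mean_ge0.
have [es|es] := ltP eps (sigma * s); last by rewrite mulr0 mul0r.
have [xz|xz] := leP `|(x : E) - z| (`|z| / 2); last by rewrite mulr0.
rewrite !mulr1; apply: IH => [|y|y w mw yw].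
- exact: (bm_shift sepE _ bf).
- exact: f0.
apply: (fP _ (w + sigma * s)).
  by rewrite -addn1 natrD mulrDl mul1r lerD// ltW.
have sE : (sigma * s) *: (sigma *: z) = s *: z.
  by rewrite scalerA mulrAC ss mul1r.
have ns : `|s| = sigma * s.
  rewrite -[LHS]mul1r -s1 -normrM ger0_norm//; lra.
rewrite scalerDl sE.
rewrite (_ : _ - _ = s *: ((x : E) - z) + (y - w *: (sigma *: z))); last first.
  by rewrite scalerBr addrACA -opprD [_ *: z + _]addrC.
rewrite (le_trans (ler_normD _ _))// normrZ ns mulrDl addrC lerD//.
by rewrite ler_wpM2l//; lra.
Qed.

(** The block length m is chosen such that C_m in [conv_pow_cone] lies outside
    the ball of radius 4 t, and the number n of blocks such that the bound 1 / n
    of [conv_pow_block] is below the probability of C_m. If the absolute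
    value of the scale exceeds eps with probability more than c, then the scale
    or its opposite does with probability more than c / 2, whence the sign
    sigma. *)
Lemma mixing_infinitesimal (t eps c : R) : 0 <= t -> 0 < eps -> 0 < c ->
  exists n : nat, forall lam : probability R R,
    (forall j, (j <= n)%N ->
      \int[conv_pow (mix lam) j]_x ind (t < `|x : E|) <= 4^-1) ->
    \int[lam]_s ind (eps < `|s|) <= c.
Proof.
move=> t0 eps0 c0.
have z1 : 0 < `|z| by rewrite normr_gt0.
have ez0 : 0 < eps * (`|z| / 2) by rewrite mulr_gt0 ?divr_gt0.
pose m := (Num.truncn (4 * t / (eps * (`|z| / 2)))).+1.
have mP : 4 * t < m%:R * eps * (`|z| / 2).
  by rewrite -mulrA -ltr_pdivrMr// truncnS_gt.
pose q := p * (c / 2).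
have q0 : 0 < q ^+ m by rewrite exprn_gt0 ?mulr_gt0 ?divr_gt0.
pose n := (Num.truncn (q ^+ m)^-1).+1.
have nP : 1 < n%:R * q ^+ m by rewrite -ltr_pdivrMr// div1r truncnS_gt.
exists (n * m)%N => lam htail.
have hblock := @conv_pow_block _ _ sepE (conv_pow (mix lam) m) t n t0.
have {}hblock : n%:R * \int[conv_pow (mix lam) m]_z (ind (4 * t < `|z : E|)) <= 1 :> R.
  apply: hblock => j jn; rewrite -(eq_law_mean _ (conv_powM sepE (mix lam) m j)).
  by apply: htail; rewrite leq_mul2r jn orbT.
rewrite leNgt; apply/negP => hc.
have cone sigma : sigma * sigma = 1 ->
    ~ c / 2 < \int[lam]_s ind (eps < sigma * s).
  move=> ss h.
  have : (p * \int[lam]_s ind (eps < sigma * s)) ^+ m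
      <= \int[conv_pow (mix lam) m]_z (ind (4 * t < `|z : E|)).
    apply: (@conv_pow_cone lam eps sigma m (fun z : E => ind (4 * t < `|z|))) => //.
    - exact: bm_norm_gt_id.
    move=> y w mw yw; have s1 : `|sigma| = 1.
      by apply/eqP; rewrite -sqrp_eq1// -normrX expr2 ss normr1.
    have w0 : 0 <= w by apply: le_trans mw; rewrite mulr_ge0// ltW.
    have := ler_normB y (y - w *: (sigma *: z)).
    rewrite subKr !normrZ s1 mul1r (ger0_norm w0) => hy.
    have : m%:R * eps * (`|z| / 2) <= w * (`|z| / 2) by rewrite ler_pM2r//; lra.
    move=> hw; suff -> : 4 * t < `|y| by [].
    lra.
  apply/negP; rewrite -ltNge.
  rewrite (@le_lt_trans _ _ (n%:R^-1))//; first
    by rewrite -[leRHS]mul1r ler_pdivlMr// mulrC.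
  rewrite (@lt_le_trans _ _ (q ^+ m))//; first
    by rewrite -[ltLHS]mul1r ltr_pdivrMr// mulrC.
  rewrite lerXn2r ?nnegrE ?mulr_ge0 ?(ltW p0)//; [lra| |].
    by apply: mean_ge0 => s; rewrite ler0n.
  by rewrite ler_pM2l// ltW.
have := cone 1 (mulr1 1); have := cone (-1).
rewrite mulrNN mulr1 => /(_ erefl) /negP; rewrite -leNgt => h1 /negP.
rewrite -leNgt => h2.
have bs sigma : bounded_measurable (fun s : R => ind (eps < sigma * s) : R).
  by apply: bm_bool; apply: measurable_fun_ltr => //; exact: measurable_funM.
have : \int[lam]_s ind (eps < `|s|)
    <= \int[lam]_s (ind (eps < -1 * s) + ind (eps < 1 * s)).
  apply: le_mean; [exact: bm_norm_gtR|exact: bmD|].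
  move=> s; rewrite mul1r mulN1r.
  have [_|s1] := ltP eps s; have [_|s2] := ltP eps (- s);
    have [ss|_] := ltP eps `|s|; rewrite /=; try lra.
  have : `|s| <= eps by rewrite ler_norml; apply/andP; split; lra.
  by lra.
by rewrite meanD//; lra.
Qed.

End mixing_tails.

(** * Weak convergence *)

Section bounded_convergence.
Context d (T : measurableType d) (R : realType) (P : probability T R).

Lemma mean_cvg (f_ : nat -> T -> R) (f : T -> R) :
  (forall n, measurable_fun setT (f_ n)) -> bounded_measurable f ->
  (forall n x, 0 <= f_ n x <= 1) ->
  (forall x, f_ n x @[n --> \oo] --> f x) ->
  \int[P]_x f_ n x @[n --> \oo] --> \int[P]_x f x.
Proof.
move=> mf_ bf f01 ff.
have [//|||||_ _ h] := @dominated_convergence _ T R P setT measurableT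
  (fun n x => (f_ n x)%:E) (EFin \o f) (cst 1%E).
- by move=> n; apply/measurable_EFinP.
- by apply/measurable_EFinP; case: bf.
- by apply: aeW => x _; apply/fine_cvgP; split; [exact: nearW|exact: ff].
- exact: finite_measure_integrable_cst.
- apply: aeW => x n _; rewrite lee_fin ger0_norm; by case/andP: (f01 n x).
apply: fine_cvg; rewrite /Rintegral fineK//.
by apply: integrable_fin_num => //; exact: bm_integrable.
Qed.

(** Tightness of a single law. *)
Lemma tail_exists (g : T -> R) (e : R) : measurable_fun setT g -> 0 < e ->
  exists K : R, 0 < K /\ \int[P]_x ind (K < g x) < e.
Proof.
move=> mg e0.
have bK K : bounded_measurable (fun x => ind (K < g x) : R).
  by apply: bm_bool; exact: measurable_fun_ltr.
have h : \int[P]_x ind (n.+1%:R < g x) @[n --> \oo] --> \int[P]_x (0 : R).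
  apply: mean_cvg.
  - by move=> n; case: (bK n.+1%:R).
  - exact: bm_cst.
  - by move=> n x; rewrite ler0n lern1 leq_b1.
  - move=> x; apply: cvg_near_cst; near=> n; rewrite ltNge.
    suff -> : g x <= n.+1%:R by [].
    rewrite (@le_trans _ _ n%:R)//; last by rewrite ler_nat.
    by near: n; exact: nbhs_infty_ger.
move: h; rewrite mean_cst => /cvgrPdist_lt/(_ _ e0)[n _ /(_ n (leqnn n))] /=.
rewrite sub0r normrN ger0_norm; last by apply: mean_ge0 => x; rewrite ler0n.
by move=> h; exists n.+1%:R.
Unshelve. all: by end_near. Qed.

End bounded_convergence.

Section test_functions.
Context (R : realType).

Definition unif_cont (V : normedZmodType R) (f : V -> R) :=
  forall e, 0 < e -> exists2 d, 0 < d &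
    forall x y, `|x - y| < d -> `|f x - f y| < e.

Definition test_fun (V : normedZmodType R) (f : V -> R) :=
  unif_cont f /\ forall x, 0 <= f x <= 1.

(** A one-sided bound is enough, by symmetry in x and y. *)
Lemma lipschitz_test (V : normedZmodType R) (f : V -> R) (L : R) :
  (forall x y, f x <= f y + L * `|x - y|) -> (forall x, 0 <= f x <= 1) ->
  test_fun f.
Proof.
move=> fL f01; split=> // e e0.
have L0 : 0 < `|L| + 1 by rewrite ltr_wpDl.
exists (e / (`|L| + 1)); first by rewrite divr_gt0.
move=> x y xy; have := fL x y; have := fL y x; rewrite distrC => h1 h2.
have h3 : L * `|x - y| < e.
  rewrite (@le_lt_trans _ _ ((`|L| + 1) * `|x - y|))//.
    by rewrite ler_wpM2r// ler_wpDr// ler_norm.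
  by rewrite mulrC -ltr_pdivlMr.
by rewrite ltr_norml; apply/andP; split; lra.
Qed.

(** The test class K is a parameter because T only carries a sigma-algebra: for
    T := borel E, uniform continuity refers to the norm of E. *)
Definition converges_on d (T : measurableType d) (K : (T -> R) -> Prop)
    (I : Type) (F : set_system I) (P_ : I -> probability T R)
    (P : probability T R) :=
  forall f, K f -> \int[P_ i]_x f x @[i --> F] --> \int[P]_x f x.

Lemma converges_on_law d (T : measurableType d) (K : (T -> R) -> Prop)
    (I : Type) (F : set_system I) (P_ P_' : I -> probability T R)
    (P P' : probability T R) :
  (forall i, same_law (P_ i) (P_' i)) -> same_law P P' ->
  converges_on K F P_ P -> converges_on K F P_' P'.
Proof.
move=> h h' c f Kf; rewrite -(eq_law_mean _ h').
rewrite (_ : (fun i => _) = (fun i => \int[P_ i]_x f x)); first exact: c.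
by apply/funext => i; rewrite (eq_law_mean _ (h i)).
Qed.

Lemma unif_cont_continuous (V : normedModType R) (f : V -> R) :
  unif_cont f -> continuous f.
Proof.
move=> uf x; apply/cvgrPdist_lt => e e0; have [d d0 fd] := uf _ e0.
near=> y; apply: fd; near: y; exact: cvgr_dist_lt.
Unshelve. all: by end_near. Qed.

Lemma test_bmR (f : R -> R) : @test_fun R f -> bounded_measurable f.
Proof.
move=> [uf f01]; apply: bm_unit => //; apply: continuous_measurable_fun.
exact: (@unif_cont_continuous R^o).
Qed.

End test_functions.

Section weak_convergence.
Context (R : realType) (E : completeNormedModType R).

Lemma test_bm (f : E -> R) : test_fun f -> bounded_measurable (f : borel E -> R).
Proof.
move=> [uf f01]; apply: bm_unit => //; apply: measurable_borel_continuous.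
exact: unif_cont_continuous.
Qed.

Hypothesis sepE : separable E.
Variable mu : probability (borel E) R.
Local Notation convolve := (convolve sepE).
Local Notation mix := (mix sepE mu).

(** The modulus of continuity of f at scale d / K serves for the vectors of norm
    at most K; the others have small probability. Lipschitz test functions
    would not be preserved, since the norm need not be integrable. *)
Lemma test_scale (f : E -> R) : test_fun f ->
  @test_fun R R (fun s => \int[mu]_x f (s *: (x : E))).
Proof.
move=> tf; have bf := test_bm tf; have [uf f01] := tf.
have bfs s := bm_homothety sepE s bf.
split; last first.
  move=> s; rewrite mean_ge0 ?mean_le//; move=> x; by case/andP: (f01 (s *: (x : E))).
move=> e e0; have e30 : 0 < e / 3 by rewrite divr_gt0.
have [d d0 fd] := uf _ e30.
have cid : continuous (fun x : E => x) by move=> x; exact: cvg_id.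
have [K [K0 KP]] := tail_exists mu (measurable_borel_norm cid) e30.
exists (d / K); first by rewrite divr_gt0.
move=> s s' ss; rewrite -meanB//.
have bK := @bm_norm_gt_id R E K.
rewrite (@le_lt_trans _ _ (\int[mu]_x (e / 3 + ind (K < `|x : E|))))//; last first.
  by rewrite meanD ?mean_cst//; [lra|exact: bm_cst].
have bb : bounded_measurable ((fun x => e / 3 + ind (K < `|x : E|)) : borel E -> R).
  by apply: bmD => //; exact: bm_cst.
have ptw x : `|f (s *: x) - f (s' *: x)| <= e / 3 + ind (K < `|x : E|).
  have [Kx|Kx] := ltP K `|x|; rewrite /=.
    have := f01 (s *: x); have := f01 (s' *: x) => /andP[? ?] /andP[? ?].
    by rewrite ler_norml; apply/andP; split; lra.
  rewrite addr0 ltW//; apply: fd; rewrite -scalerBl normrZ.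
  rewrite (@le_lt_trans _ _ (`|s - s'| * K))//; first by rewrite ler_wpM2l.
  by rewrite -ltr_pdivlMr.
by apply: norm_mean_le => //; exact: bmB.
Qed.

Lemma converges_mix I (F : set_system I) (lam_ : I -> probability R R)
    (lam : probability R R) :
  converges_on (T := R) (@test_fun R R) F lam_ lam ->
  converges_on (T := borel E) (@test_fun R E) F (fun i => mix (lam_ i)) (mix lam).
Proof.
move=> c f tf; rewrite mean_mix; last exact: test_bm.
rewrite (_ : (fun i => _) = (fun i => \int[lam_ i]_s \int[mu]_x f (s *: (x : E)))).
  exact: (c _ (test_scale tf)).
by apply/funext => i; rewrite mean_mix//; exact: test_bm.
Qed.

Lemma test_shift (f : E -> R) (a : E) : test_fun f -> test_fun (fun y => f (a + y)).
Proof.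
move=> [uf f01]; split=> // e /uf[d d0 fd]; exists d => // x y xy.
by apply: fd; rewrite opprD addrACA subrr add0r.
Qed.

Lemma test_average (P : probability (borel E) R) (f : E -> R) : test_fun f ->
  test_fun (fun x : E => \int[P]_y f (x + (y : E))).
Proof.
move=> tf; have bf := test_bm tf; have [uf f01] := tf.
have bfs x := bm_shift sepE x bf.
split; last first.
  move=> s; rewrite mean_ge0 ?mean_le//; move=> x; by case/andP: (f01 (s + (x : E))).
move=> e e0; have e20 : 0 < e / 2 by rewrite divr_gt0.
have [d d0 fd] := uf _ e20; exists d => // x x' xx.
rewrite -meanB// (@le_lt_trans _ _ (e / 2))//; last lra.
apply: norm_mean => [|y]; first exact: bmB.
by rewrite ltW//; apply: fd; rewrite opprD addrACA subrr addr0.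
Qed.

(** A uniformly continuous substitute for the indicator of the complement of the
    union of the balls of radius d around the first n points of e. *)
Fixpoint gap (e : nat -> E) (d : R) n (x : E) : R :=
  if n is k.+1 then Num.min (gap e d k x) (`|x - e k| / d) else 1.

Lemma gap01 e d n x : 0 < d -> 0 <= gap e d n x <= 1.
Proof.
move=> d0; elim: n => [|n /andP[IH0 IH1]] /=; first by rewrite ler01 lexx.
by rewrite le_min IH0 divr_ge0 ?(ltW d0)//= ge_min IH1.
Qed.

Lemma test_gap e d n : 0 < d -> test_fun (gap e d n).
Proof.
move=> d0; apply: (@lipschitz_test _ _ _ d^-1) => [x y|x]; last exact: gap01.
elim: n => [|n IH] /=; first by rewrite lerDl mulr_ge0// invr_ge0 ltW.
have h : `|x - e n| / d <= `|y - e n| / d + d^-1 * `|x - y|.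
  rewrite [_ * `|_|]mulrC -mulrDl ler_pM2r ?invr_gt0//.
  by rewrite -(subrK y x) -addrA addrC (le_trans (ler_normD _ _))// addrC addrK.
rewrite ge_min; case: (leP (gap e d n y) (`|y - e n| / d)) => _.
  by rewrite IH.
by rewrite h orbT.
Qed.

Lemma gap_near e d n x : 0 < d -> gap e d n x < 1 ->
  exists k, (k < n)%N /\ `|x - e k| < d.
Proof.
move=> d0; elim: n => [|n IH] /=; first by rewrite ltxx.
rewrite gt_min => /orP[/IH[k [kn xk]]|h]; first by exists k; split => //; exact: ltnW.
by exists n; split => //; move: h; rewrite ltr_pdivrMr// mul1r.
Qed.

Lemma gap_cvg0 e d x : 0 < d ->
  (forall (x : E) (r : R), 0 < r -> exists n, `|x - e n| < r) ->
  gap e d n x @[n --> \oo] --> (0 : R).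
Proof.
move=> d0 eP; apply/cvgrPdist_lt => r r0.
have [k xk] := eP x _ (mulr_gt0 d0 r0).
exists k.+1 => // n /= kn.
have g0 := gap01 e n x d0; rewrite sub0r normrN ger0_norm; last by case/andP: g0.
elim: n kn {g0} => // n IH; rewrite ltnS leq_eqVlt => /predU1P[<-|kn] /=.
  by rewrite gt_min ltr_pdivrMr// [r * d]mulrC xk orbT.
by rewrite gt_min IH.
Qed.

(** The averages h_i of f with respect to Q_ i are equicontinuous and converge
    pointwise, hence uniformly near the first n points of a dense sequence. Up
    to a small mass, P charges only the neighbourhood of these points if n is
    large, and so does P_ i eventually, because the gap function is a test
    function. This replaces tightness of the family P_. *)
Lemma converges_convolve I (F : set_system I) {FF : Filter F}
    (P_ Q_ : I -> probability (borel E) R) (P Q : probability (borel E) R) :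
  converges_on (T := borel E) (@test_fun R E) F P_ P ->
  converges_on (T := borel E) (@test_fun R E) F Q_ Q ->
  converges_on (T := borel E) (@test_fun R E) F
    (fun i => convolve (P_ i) (Q_ i)) (convolve P Q).
Proof.
move=> cP cQ f tf; have bf := test_bm tf; have [uf f01] := tf.
rewrite mean_conv//; under eq_fun do rewrite mean_conv//.
pose h (Q' : probability (borel E) R) (x : E) := \int[Q']_y f (x + (y : E)).
have th Q' : test_fun (h Q') by exact: test_average.
apply/cvgrPdist_lt => r r0; pose r1 := r / 6.
have r10 : 0 < r1 by rewrite divr_gt0.
have [d d0 fd] := uf _ r10.
have hd Q' x x' : `|x - x'| < d -> `|h Q' x - h Q' x'| <= r1.
  move=> xx; rewrite /h -meanB; try exact: (bm_shift sepE _ bf).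
  apply: norm_mean => [|y]; first by apply: bmB; exact: (bm_shift sepE _ bf).
  by rewrite ltW//; apply: fd; rewrite opprD addrACA subrr addr0.
have [e eP] := separable_seq sepE.
have [n nP] : exists n, \int[P]_x gap e d n x < r1.
  have h0 : \int[P]_x gap e d n x @[n --> \oo] --> \int[P]_x (0 : R).
    apply: mean_cvg.
    - by move=> n; have [] := test_bm (test_gap e n d0).
    - exact: bm_cst.
    - by move=> n x; exact: gap01.
    - by move=> x; exact: gap_cvg0.
  move: h0; rewrite mean_cst => /cvgrPdist_lt/(_ _ r10)[n _ /(_ n (leqnn n))] /=.
  rewrite sub0r normrN ger0_norm; first by exists n.
  by apply: mean_ge0 => x; case/andP: (gap01 e n x d0).
have nearh : \forall i \near F, forall k : 'I_n, `|h Q (e k) - h (Q_ i) (e k)| < r1.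
  apply: filter_forall => k.
  by have /cvgrPdist_lt/(_ _ r10) := cQ _ (test_shift (e k) tf).
have nearg : \forall i \near F, \int[P_ i]_x gap e d n x < r1.
  exact: (cvgr_lt _ (cP _ (test_gap e n d0))).
have nearP : \forall i \near F, `|\int[P]_x h Q x - \int[P_ i]_x h Q x| < r1.
  by have /cvgrPdist_lt/(_ _ r10) := cP _ (th Q).
near=> i.
have hi : `|\int[P_ i]_x h Q x - \int[P_ i]_x h (Q_ i) x| <= 3 * r1 + r1.
  rewrite -meanB; try exact: test_bm.
  apply: (@le_trans _ _ (\int[P_ i]_x (3 * r1 + gap e d n x))); last first.
    rewrite meanD ?mean_cst; [|exact: bm_cst|exact: (test_bm (test_gap e n d0))].
    by rewrite lerD2l ltW//; near: i.
  have bg : bounded_measurable ((fun x => 3 * r1 + gap e d n x) : borel E -> R).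
    by apply: bmD; [exact: bm_cst|exact: (test_bm (test_gap e n d0))].
  have bh : bounded_measurable ((fun x => h Q x - h (Q_ i) x) : borel E -> R).
    by apply: bmB; exact: test_bm.
  have ptw x : `|h Q x - h (Q_ i) x| <= 3 * r1 + gap e d n x.
    have /andP[g0 g1] := gap01 e n x d0.
    have [gx|gx] := ltP (gap e d n x) 1; last first.
      have [_ /(_ x)/andP[? ?]] := th Q; have [_ /(_ x)/andP[? ?]] := th (Q_ i).
      by rewrite ler_norml; apply/andP; split; lra.
    have [k [kn xk]] := gap_near d0 gx.
    have h1 := hd Q _ _ xk; have h2 := hd (Q_ i) _ _ xk.
    have h3 : `|h Q (e k) - h (Q_ i) (e k)| < r1.
      have : forall k : 'I_n, `|h Q (e k) - h (Q_ i) (e k)| < r1 by near: i.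
      by move=> /(_ (Ordinal kn)).
    move: h1 h2 h3; rewrite !ler_norml ltr_norml => /andP[? ?] /andP[? ?] /andP[? ?].
    by apply/andP; split; lra.
  exact: norm_mean_le.
have h2 : `|\int[P]_x h Q x - \int[P_ i]_x h Q x| < r1 by near: i.
rewrite -(subrKA (\int[P_ i]_x h Q x)) (le_lt_trans (ler_normD _ _))//.
by move: hi h2; rewrite /r1 /h; lra.
Unshelve. all: by end_near. Qed.

End weak_convergence.

(** Test functions determine a law: the indicator of an open set U is the limit
    of the functions min 1 (n * depth U), where the depth of a point in U is its
    distance to the complement of U, cut at 1 so that U may be the whole
    space. *)
Section test_functions_separate.
Context (R : realType) (E : completeNormedModType R).

Let distances (U : set E) (x : E) : set R :=
  [set r | r = 1 \/ exists2 y, ~ U y & r = `|x - y|].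

Let depth (U : set E) (x : E) : R := inf (distances U x).

Let distances_ge0 U x : lbound (distances U x) 0.
Proof. by move=> r [->//|[y _ ->]]. Qed.

Let depth_le U x r : distances U x r -> depth U x <= r.
Proof. by move=> h; apply: ge_inf => //; exists 0; exact: distances_ge0. Qed.

Let le_depth U x r : lbound (distances U x) r -> r <= depth U x.
Proof. by move=> h; apply: lb_le_inf => //; exists 1; left. Qed.

Let test_depth (U : set E) (n : nat) :
  test_fun (fun x => Num.min 1 (n%:R * depth U x)).
Proof.
have d0 x : 0 <= depth U x by apply: le_depth; exact: distances_ge0.
apply: (@lipschitz_test _ _ _ n%:R) => [x y|x]; last first.
  by rewrite le_min ler01 mulr_ge0//= ge_min lexx.
have dxy : depth U x <= depth U y + `|x - y|.
  rewrite -lerBlDr; apply: le_depth => r [->|[z Uz ->]]; rewrite lerBlDr.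
    by rewrite (le_trans (@depth_le U x 1 (or_introl erefl)))// lerDl.
  apply: (@le_trans _ _ `|x - z|); first by apply: depth_le; right; exists z.
  by rewrite -(subrKA y x) addrC ler_normD.
rewrite ge_min; case: (leP 1 (n%:R * depth U y)) => _.
  by rewrite lerDl mulr_ge0.
by rewrite -mulrDr (ler_wpM2l _ dxy) ?orbT.
Qed.

Let depth_cvg (U : set E) (x : E) : open U ->
  Num.min 1 (n%:R * depth U x) @[n --> \oo] --> (\1_U x : R).
Proof.
move=> oU; rewrite indicE; have [/[!inE] Ux|/negP] := boolP (x \in U); last first.
  rewrite inE => Ux; apply: cvg_near_cst; apply: nearW => n.
  rewrite (_ : depth U x = 0) ?mulr0; first by rewrite min_r// ler01.
  apply/eqP; rewrite eq_le; apply/andP; split.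
    by apply: depth_le; right; exists x => //; rewrite subrr normr0.
  by apply: le_depth; exact: distances_ge0.
have /nbhs_ballP[r /= r0 rU] : nbhs x U by apply: open_nbhs_nbhs; split.
have d0 : Num.min 1 r <= depth U x.
  apply: le_depth => s [->|[y Uy ->]]; first by rewrite ge_min lexx.
  rewrite ge_min [r <= _]leNgt; apply/orP; right; apply/negP => xy; apply: Uy.
  by apply: rU; rewrite -ball_normE.
have m0 : 0 < Num.min 1 r by rewrite lt_min ltr01.
apply: cvg_near_cst; near=> n; apply: min_l.
rewrite -ler_pdivrMr ?(lt_le_trans m0)//.
by near: n; exact: nbhs_infty_ger.
Unshelve. all: by end_near. Qed.

Lemma same_law_test (P Q : probability (borel E) R) :
  (forall f : E -> R, test_fun f ->
    \int[P]_x f (x : E) = \int[Q]_x f (x : E)) ->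
  same_law P Q.
Proof.
move=> PQ; have openT' : @open E setT by exact: openT.
apply: (@measure_unique _ _ (borel E) (@open E) (fun=> setT)) => //.
- by move=> A B; exact: openI.
- by rewrite bigcup_const.
- move=> U oU; have mU : measurable (U : set (borel E)) by exact: open_measurable_borel.
  rewrite -[LHS]fineK ?fin_num_measure// -[RHS]fineK ?fin_num_measure//.
  rewrite -!mean_indic//; congr EFin.
  have h (P' : probability (borel E) R) :
      \int[P']_x Num.min 1 (n%:R * depth U (x : E)) @[n --> \oo] --> \int[P']_x \1_U x.
    apply: mean_cvg => [n||n x|x].
    - by have [] := test_bm (test_depth U n).
    - apply: bm_unit; first exact: measurable_indic.
      by move=> x; rewrite indicE ler0n lern1 leq_b1.
    - by have [_] := test_depth U n.
    - exact: depth_cvg.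
  have hP := h P; rewrite (_ : (fun n => _) =
      (fun n => \int[Q]_x Num.min 1 (n%:R * depth U (x : E)))) in hP.
    exact: (cvg_unique _ hP (h Q)).
  by apply/funext => n; exact: (PQ _ (test_depth U n)).
- by move=> _; rewrite -ge0_fin_numE// fin_num_measure.
Qed.

Lemma converges_unique I (F : set_system I) {FF : ProperFilter F}
    (P_ : I -> probability (borel E) R) (P Q : probability (borel E) R) :
  converges_on (T := borel E) (@test_fun R E) F P_ P ->
  converges_on (T := borel E) (@test_fun R E) F P_ Q -> same_law P Q.
Proof.
by move=> cP cQ; apply: same_law_test => f tf; apply: cvg_unique (cP f tf) (cQ f tf).
Qed.

End test_functions_separate.

(** * Compactness of tight families of laws on the real line *)

(** Compactness of the unit interval. *)
Lemma ultra_cvg_unit (R : realType) I (U : set_system I) (u : I -> R) :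
  UltraFilter U -> (forall i, 0 <= u i <= 1) -> exists l : R, u i @[i --> U] --> l.
Proof.
move=> UU u01; have UP : ProperFilter U by exact: ultra_proper.
have [|l [_ lP]] := @segment_compact R 0 1 (fmap u U) (fmap_proper_filter u UP).
  by apply: (@filterE _ U) => i; rewrite /= in_itv /= u01.
exists l => B lB; have [//|UB] := in_ultra_setVsetC (u @^-1` B) UU.
have [|x [/= xB Bx]] := lP (~` B) B _ lB; last by [].
exact: UB.
Qed.

Section regularization.
Context (R : realType) (F : R -> R).
Hypothesis F_nd : {homo F : x y / x <= y}.
Hypothesis F01 : forall x, 0 <= F x <= 1.
Hypothesis F_Ny : forall e : R, 0 < e -> exists x, F x < e.
Hypothesis F_y : forall e : R, 0 < e -> exists x, 1 - e < F x.

(** A pointwise limit F of distribution functions need not be right-continuous;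
    this is the right-continuous function that agrees with F at its points of
    continuity. *)
Definition rreg (x : R) : R := inf (F @` [set y | x < y]).

Lemma rreg_le x y : x < y -> rreg x <= F y.
Proof.
move=> xy; apply: ge_inf; last by exists y.
by exists 0 => _ [z _ <-]; case/andP: (F01 z).
Qed.

Lemma le_rreg x r : (forall y, x < y -> r <= F y) -> r <= rreg x.
Proof.
move=> h; apply: lb_le_inf; first
  by exists (F (x + 1)); exists (x + 1) => //=; rewrite ltrDl.
by move=> _ [y xy <-]; exact: h.
Qed.

Lemma F_le_rreg x : F x <= rreg x.
Proof. by apply: le_rreg => y xy; apply: F_nd; exact: ltW. Qed.

Lemma rreg_nd : nondecreasing rreg.
Proof.
by move=> x y xy; apply: le_rreg => z yz; apply: rreg_le; exact: le_lt_trans yz.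
Qed.

Lemma rreg_rc : right_continuous rreg.
Proof.
move=> x; apply/cvgrPdist_lt => e e0.
have [y xy Fy] : exists2 y, x < y & F y < rreg x + e.
  apply: contrapT => h; have : rreg x + e <= rreg x.
    apply: le_rreg => y xy; rewrite leNgt; apply/negP => Fy; apply: h.
    by exists y.
  by rewrite gerDl leNgt e0.
near=> z.
have xz : x < z by near: z; exact: nbhs_right_gt.
have zy : z < y by near: z; exact: nbhs_right_lt.
have := rreg_le zy; have := rreg_nd (ltW xz) => h1 h2.
by rewrite ler0_norm; lra.
Unshelve. all: by end_near. Qed.

Lemma rreg_Ny : rreg @ -oo --> (0 : R).
Proof.
apply/cvgrPdist_lt => e e0; have [x Fx] := F_Ny e0.
near=> z.
have zx : z < x by near: z; apply: nbhs_ninfty_lt; rewrite num_real.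
have := rreg_le zx; have := F_le_rreg z; have /andP[h0 _] := F01 z => h1 h2.
by rewrite sub0r normrN ger0_norm; lra.
Unshelve. all: by end_near. Qed.

Lemma rreg_y : rreg @ +oo --> (1 : R).
Proof.
apply/cvgrPdist_lt => e e0; have [x Fx] := F_y e0.
near=> z.
have xz : x <= z by near: z; apply: nbhs_pinfty_ge; rewrite num_real.
have := F_nd xz; have := F_le_rreg z.
have : rreg z <= 1.
  have z1 : z < z + 1 by rewrite ltrDl.
  by apply: le_trans (rreg_le z1) _; case/andP: (F01 (z + 1)).
by move=> h1 h2 h3; rewrite ger0_norm; lra.
Unshelve. all: by end_near. Qed.

HB.instance Definition _ := isCumulative.Build R _ R rreg rreg_nd rreg_rc.
HB.instance Definition _ :=
  isCumulativeBounded.Build R 0 1 rreg rreg_Ny rreg_y.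

(* The Stieltjes measure is a measure for another display of the Borel sets of
   the line, hence this copy. *)
Let lsm : set R -> \bar R := lebesgue_stieltjes_measure rreg.
Let lsm_law := (lebesgue_stieltjes_measure rreg : probability _ R).

Let lsm0 : lsm set0 = 0%E. Proof. exact: measure0. Qed.
Let lsm_ge0 A : (0 <= lsm A)%E. Proof. exact: measure_ge0. Qed.
Let lsm_sigma_additive : semi_sigma_additive lsm.
Proof. exact: (@measure_semi_sigma_additive _ _ _ lsm_law). Qed.
Let lsmT : lsm setT = 1%E. Proof. exact: (probability_setT lsm_law). Qed.

HB.instance Definition _ := isMeasure.Build _ _ _ lsm lsm0 lsm_ge0 lsm_sigma_additive.
HB.instance Definition _ := Measure_isProbability.Build _ _ _ lsm lsmT.

Lemma law_of_cdf : exists Q : probability R R,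
  forall x, \int[Q]_s ind (s <= x) = rreg x.
Proof.
exists lsm => x; rewrite (@mean_boolE _ _ _ _ `]-oo, x]%classic)//.
have := cdf_lebesgue_stieltjes_id rreg x.
rewrite /cdf /distribution /pushforward /= => h.
by rewrite [lsm _]h.
Qed.

(** The intervals between F x and rreg x are pairwise disjoint. If they were
    nonempty for all x between a and b, rational points in them would inject an
    interval into a countable set. *)
Lemma regular_dense (a b : R) : a < b ->
  exists2 x, a < x < b & rreg x = F x.
Proof.
move=> ab; apply: contrapT => h.
have jump x : a < x < b -> F x < rreg x.
  move=> axb; rewrite lt_neqAle F_le_rreg andbT eq_sym; apply/eqP => Fx.
  by apply: h; exists x.
have /choice[q qP] : forall x, exists q : rat, a < x < b ->
    F x < ratr q < rreg x.
  move=> x; have [/jump/rat_in_itvoo[q]|?] := pselect (a < x < b).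
    by rewrite in_itv /= => qP; exists q.
  by exists 0.
have cab : countable `]a, b[%classic.
  apply/countable_injP; exists (fun x => pickle (q x)) => x y.
  have mono u v : a < u < b -> a < v < b -> u < v -> q u <> q v.
    move=> /qP/andP[_ qu] /qP/andP[qv _] /rreg_le uv quv.
    by move: qu; rewrite quv ltNge (le_trans uv)// ltW.
  rewrite !inE /= !in_itv /= => xab yab /(pcan_inj pickleK) qxy.
  have [xy|xy|//] := ltgtP x y; [have := mono _ _ xab yab xy|
    have := mono _ _ yab xab xy]; by rewrite qxy.
have := countable_lebesgue_measure0 cab; rewrite lebesgue_measure_itv /= lte_fin ab.
by rewrite -EFinD => -[] /eqP; rewrite subr_eq0 gt_eqF.
Qed.

End regularization.

(** Helly's selection argument. Distribution functions converge pointwise along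
    the ultrafilter, and their limit, made right-continuous, is the distribution
    function of a law thanks to tightness. A test function f is approximated by
    step functions with jumps at points where the limit is continuous; means of
    such step functions converge. *)
Lemma tight_ultra_converges (R : realType) I (U : set_system I)
    (lam_ : I -> probability R R) : UltraFilter U ->
  (forall e : R, 0 < e -> exists M : R, forall i,
    \int[lam_ i]_s ind (M < `|s|) < e) ->
  exists lam : probability R R, converges_on (T := R) (@test_fun R R) U lam_ lam.
Proof.
move=> UU tight; have UP : ProperFilter U by exact: ultra_proper.
have bs x : bounded_measurable (fun s : R => ind (s <= x) : R).
  by apply: bm_bool; exact: measurable_fun_ler.
have ind01 (b : bool) : 0 <= (ind b : R) <= 1 by rewrite ler0n lern1 leq_b1.
have /choice[F FP] : forall x, exists l : R,
    \int[lam_ i]_s ind (s <= x) @[i --> U] --> l.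
  move=> x; apply: ultra_cvg_unit => i.
  by rewrite mean_ge0 ?mean_le//; move=> s; case/andP: (ind01 (s <= x)).
have F_le x r : (forall i, \int[lam_ i]_s ind (s <= x) <= r) -> F x <= r.
  by move=> h; apply: (cvgr_to_le (FP x)); exact: filterE.
have le_F x r : (forall i, r <= \int[lam_ i]_s ind (s <= x)) -> r <= F x.
  by move=> h; apply: (cvgr_to_ge (FP x)); exact: filterE.
have F_nd : {homo F : x y / x <= y}.
  move=> x y xy; rewrite -subr_ge0.
  apply: (cvgr_to_ge (cvgB (FP y) (FP x))); apply: filterE => i.
  rewrite subr_ge0; apply: le_mean => // s; rewrite ler_nat.
  by have [sx|//] := leP s x; rewrite (le_trans sx xy).
have F01 x : 0 <= F x <= 1.
  apply/andP; split; [apply: le_F|apply: F_le] => i.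
    by apply: mean_ge0 => s; case/andP: (ind01 (s <= x)).
  by apply: mean_le => // s; case/andP: (ind01 (s <= x)).
have F_Ny (e : R) : 0 < e -> exists x, F x < e.
  move=> e0; have e20 : 0 < e / 2 by rewrite divr_gt0.
  have [M MP] := tight _ e20; exists (- M - 1).
  apply: (@le_lt_trans _ _ (e / 2)); last lra.
  apply: F_le => i; apply: le_trans (ltW (MP i)).
  apply: le_mean => // [|s]; first exact: bm_norm_gtR.
  rewrite ler_nat; have [sM|//] := leP s (- M - 1).
  suff -> : M < `|s| by [].
  by have := ler_norm (- s); rewrite normrN; lra.
have F_y (e : R) : 0 < e -> exists x, 1 - e < F x.
  move=> e0; have e20 : 0 < e / 2 by rewrite divr_gt0.
  have [M MP] := tight _ e20; exists M.
  apply: (@lt_le_trans _ _ (1 - e / 2)); first lra.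
  apply: le_F => i; apply: (@le_trans _ _ (1 - \int[lam_ i]_s ind (M < `|s|))).
    by rewrite lerD2l lerN2 ltW.
  rewrite -[X in X - _](mean_cst (lam_ i)) -meanB; [|exact: bm_cst|exact: bm_norm_gtR].
  apply: le_mean => // [|s]; first by apply: bmB; [exact: bm_cst|exact: bm_norm_gtR].
  have [sM|sM] := leP s M; have [Ms|Ms] := ltP M `|s|; rewrite /=; try lra.
  by have := ler_norm s; lra.
have [lam lamP] := law_of_cdf F_nd F01 F_Ny F_y; exists lam => f tf.
(* good functions are those whose means converge *)
pose good (g : R -> R) := bounded_measurable g /\
  \int[lam_ i]_s g s @[i --> U] --> \int[lam]_s g s.
have good_ind x : rreg F x = F x -> good (fun s => ind (s <= x)).
  by move=> Fx; split => //; rewrite lamP Fx; exact: FP.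
have good_cst r : good (fun=> r).
  split; first exact: bm_cst.
  rewrite mean_cst (_ : (fun i => _) = fun=> r); first exact: cvg_cst.
  by apply/funext => i; rewrite mean_cst.
have goodD g h : good g -> good h -> good (fun s => g s + h s).
  move=> [bg cg] [bh ch]; split; first exact: bmD.
  rewrite meanD// (_ : (fun i => _) =
    (fun i => \int[lam_ i]_s g s + \int[lam_ i]_s h s)); first exact: cvgD.
  by apply/funext => i; rewrite meanD.
have goodZ r g : good g -> good (fun s => r * g s).
  move=> [bg cg]; split; first by apply: bmM => //; exact: bm_cst.
  rewrite meanZ// (_ : (fun i => _) = (fun i => r * \int[lam_ i]_s g s)).
    by apply: cvgM => //; exact: cvg_cst.
  by apply/funext => i; rewrite meanZ.
have bf := test_bmR tf; have [uf f01] := tf.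
apply/cvgrPdist_lt => e e0; pose e1 := e / 8.
have e10 : 0 < e1 by rewrite divr_gt0.
have [d d0 fd] := uf _ e10.
have [a0 a0P] := F_Ny _ e10; have [b0 b0P] := F_y _ e10.
have a01 : a0 - 1 < a0 by rewrite gtrBl.
have [a aa Fa] := regular_dense F_nd F01 a01.
have {aa} Fae : F a < e1.
  by apply: le_lt_trans a0P; apply: F_nd; case/andP: aa => ?; exact: ltW.
(* A good step function g that is e1-close to f on the interval from a to x and
   vanishes elsewhere; each step of the induction moves x by at least d / 2. *)
have step n : exists x, [/\ a + n%:R * (d / 2) <= x, rreg F x = F x &
    exists g, [/\ good g,
      forall s, a < s -> s <= x -> `|f s - g s| <= e1 &
      forall s, s <= a \/ x < s -> g s = 0]].
  elim: n => [|n [x [nx Fx [g [gg gf g0]]]]].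
    exists a; rewrite mul0r addr0; split => //; exists (fun=> 0); split => //.
    by move=> s as_ sa; move: as_; rewrite ltNge sa.
  have xd : x + d / 2 < x + d by rewrite ltrD2l gtr_pMr// invf_lt1// ltr1n.
  have [y /andP[xy yx] Fy] := regular_dense F_nd F01 xd.
  exists y; split => //.
    by rewrite -addn1 natrD mulrDl mul1r; lra.
  exists (fun s => g s + f y * (ind (s <= y) + (-1) * ind (s <= x))); split.
  - apply: (goodD _ _ gg); apply: (@goodZ).
    by apply: (@goodD); [exact: good_ind|apply: (@goodZ); exact: good_ind].
  - move=> s as_ sy; rewrite sy; have [sx|xs] := leP s x.
      by rewrite mulN1r subrr mulr0 addr0; exact: gf.
    rewrite g0; last by right.
    rewrite mulr0 addr0 mulr1 add0r ltW//; apply: fd.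
    by rewrite distrC ger0_norm; lra.
  - have axx : a <= x.
      by apply: le_trans nx; rewrite lerDl mulr_ge0// divr_ge0// ltW.
    move=> s [sa|ys].
      rewrite g0; last by left.
      rewrite (le_trans sa axx) (le_trans sa)//; last lra.
      by rewrite mulN1r subrr mulr0 addr0.
    rewrite g0; last by right; lra.
    by rewrite !leNgt ys (_ : x < s) /= ?mulr0 ?addr0 ?mulr0//; lra.
have [n nP] : exists n : nat, b0 <= a + n%:R * (d / 2).
  exists (Num.truncn ((b0 - a) / (d / 2))).+1.
  rewrite -lerBlDl -ler_pdivrMr ?divr_gt0// ltW// truncnS_gt//.
have [x [nx Fx [g [[bg cg] gf g0]]]] := step n.
have Fxe : 1 - e1 < F x.
  by apply: lt_le_trans b0P _; apply: F_nd; exact: le_trans nx.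
(* a good function that bounds the error, with mean below 3 * e1 *)
pose phi := fun s : R => e1 + (ind (s <= a) + (1 + (-1) * ind (s <= x))) : R.
have [bphi cphi] : good phi.
  apply: (@goodD); first exact: good_cst.
  apply: (@goodD); first exact: good_ind.
  by apply: (@goodD); [exact: good_cst|apply: (@goodZ); exact: good_ind].
have iphi : \int[lam]_s phi s < 3 * e1.
  rewrite /phi meanD; [|exact: bm_cst|]; last first.
    by apply: bmD => //; apply: bmD; [exact: bm_cst|apply: bmM => //; exact: bm_cst].
  rewrite mean_cst meanD//; last first.
    by apply: bmD; [exact: bm_cst|apply: bmM => //; exact: bm_cst].
  rewrite meanD; [|exact: bm_cst|by apply: bmM => //; exact: bm_cst].
  by rewrite mean_cst meanZ// !lamP Fa Fx; lra.
have near_phi : \forall i \near U, \int[lam_ i]_s phi s < 3 * e1.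
  exact: (cvgr_lt _ cphi).
have near_g : \forall i \near U, `|\int[lam]_s g s - \int[lam_ i]_s g s| < e1.
  by have /cvgrPdist_lt/(_ _ e10) := cg.
have ptw s : `|f s - g s| <= phi s.
  rewrite /phi; have [as_|sa] := ltP a s.
    have [sx|xs] := leP s x.
      by rewrite mulN1r subrr !addr0; exact: gf.
    rewrite g0; last by right.
    by case/andP: (f01 s) => ? ?; rewrite subr0 ger0_norm//= mulr0 addr0 add0r; lra.
  rewrite g0; last by left.
  case/andP: (f01 s) => ? ?; rewrite subr0 ger0_norm//=.
  by case: (s <= x); rewrite /=; lra.
have fg (Q : probability R R) : \int[Q]_s phi s < 3 * e1 ->
    `|\int[Q]_s f s - \int[Q]_s g s| < 3 * e1.
  move=> h; rewrite -meanB// (le_lt_trans _ h)//.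
  by apply: norm_mean_le => //; exact: bmB.
near=> i.
have h1 : `|\int[lam]_s f s - \int[lam]_s g s| < 3 * e1 by exact: fg.
have h2 : `|\int[lam_ i]_s f s - \int[lam_ i]_s g s| < 3 * e1.
  by apply: fg; near: i.
have h3 : `|\int[lam]_s g s - \int[lam_ i]_s g s| < e1 by near: i.
move: h1 h2 h3; rewrite !ltr_norml /e1 => /andP[? ?] /andP[? ?] /andP[? ?].
by apply/andP; split; lra.
Unshelve. all: by end_near. Qed.

(** * Absolute values and powers for the generalized convolution *)

Section nonnegative_laws.
Context (R : realType).
Implicit Types lam : probability R R.

Definition absl lam : probability R R := image_law lam (@normr_measurable R setT).

Definition nonneg lam := \int[lam]_s ind (s < 0) = 0 :> R.

Lemma bm_lt0 : bounded_measurable (fun s : R => ind (s < 0) : R).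
Proof. by apply: bm_bool; exact: measurable_fun_ltr. Qed.

Lemma nonneg_absl lam : nonneg (absl lam).
Proof.
rewrite /nonneg mean_image_law; last exact: bm_lt0.
under eq_Rintegral do rewrite ltNge normr_ge0 /=.
exact: mean_cst.
Qed.

(** The difference of the means of f is at most 2 M times the mass of the
    negative half line, for M a bound of f. *)
Lemma absl_nonneg lam : nonneg lam -> same_law lam (absl lam).
Proof.
move=> lam0; apply: same_law_mean => f bf; rewrite mean_image_law//.
have bfn : bounded_measurable (fun s : R => f `|s|).
  by apply: bm_comp => //; exact: normr_measurable.
apply/eqP; rewrite -subr_eq0 -meanB// -normr_le0.
case: (bf) => _ [M fM].
rewrite (@le_trans _ _ (\int[lam]_s (2 * M * ind (s < 0))))//; last first.
  by rewrite meanZ; [rewrite lam0 mulr0|exact: bm_lt0].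
apply: norm_mean_le.
- exact: bmB.
- by apply: bmM; [exact: bm_cst|exact: bm_lt0].
move=> s; have [s0|s0] := ltP s 0.
  rewrite mulr1 (le_trans (ler_normB _ _))//.
  by rewrite mulr_natl mulr2n lerD.
by rewrite (ger0_norm s0) subrr normr0 mulr0.
Qed.

Lemma nonneg_support lam : lam [set x | 0 <= x] = 1%E -> nonneg lam.
Proof.
move=> lam1; have m0 : measurable [set x : R | x < 0].
  by rewrite -set_itvNyo; exact: measurable_itv.
rewrite /nonneg (mean_boolE lam m0)// (_ : [set x | x < 0] = ~` [set x | 0 <= x]).
  rewrite probability_setC ?lam1 ?subee//.
  by rewrite -set_itvcy; exact: measurable_itv.
by apply/seteqP; split => x /=; rewrite ltNge => /negP.
Qed.

Lemma nonneg_dirac0 : nonneg \d_(0 : R).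
Proof. by rewrite /nonneg mean_dirac ?ltxx//; exact: bm_lt0. Qed.

(** Up to the mass outside a neighbourhood of the origin, which tends to 0, the
    mean of f only depends on the values of f near the origin. *)
Lemma mean_cvg_dirac0 I (F : set_system I) {FF : Filter F}
    (lam_ : I -> probability R R) (f : R -> R) :
  bounded_measurable f -> {for 0, continuous f} ->
  (forall eps c : R, 0 < eps -> 0 < c ->
    \forall i \near F, \int[lam_ i]_s ind (eps < `|s|) <= c) ->
  \int[lam_ i]_s f s @[i --> F] --> f 0.
Proof.
move=> bf cf tails; case: (bf) => _ [M fM].
have M0 : 0 <= M by apply: le_trans (fM 0).
apply/cvgrPdist_lt => e e0; have e20 : 0 < e / 2 by rewrite divr_gt0.
have /cvgrPdist_lt/(_ _ e20)/nbhs_ballP[d /= d0 fd] := cf.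
have d20 : 0 < d / 2 by rewrite divr_gt0.
pose c := e / (8 * (M + 1)).
have c0 : 0 < c by rewrite divr_gt0// mulr_gt0// ltr_wpDl.
near=> i.
have hi : \int[lam_ i]_s ind (d / 2 < `|s|) <= c by near: i; exact: tails.
have bd := @bm_norm_gtR R (d / 2).
rewrite -(mean_cst (lam_ i) (f 0)) -meanB//; last exact: bm_cst.
rewrite (@le_lt_trans _ _ (\int[lam_ i]_s (e / 2 + 2 * M * ind (d / 2 < `|s|))))//.
  apply: norm_mean_le.
  - by apply: bmB => //; exact: bm_cst.
  - by apply: bmD; [exact: bm_cst|apply: bmM => //; exact: bm_cst].
  move=> s; have [ds|sd] := ltP (d / 2) `|s|.
    rewrite mulr1 (le_trans (ler_normB _ _))//.
    by rewrite ler_wpDl ?(ltW e20)// mulr_natl mulr2n lerD.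
  rewrite mulr0 addr0 ltW//; apply: fd; rewrite -ball_normE /= sub0r normrN; lra.
rewrite meanD ?mean_cst ?meanZ//; [|exact: bm_cst|by apply: bmM => //; exact: bm_cst].
have : 2 * M * \int[lam_ i]_s ind (d / 2 < `|s|) <= 2 * M * c.
  by rewrite ler_wpM2l// mulr_ge0.
have : 2 * (M + 1) * c = e / 4.
  by rewrite /c; field; rewrite gt_eqF// ltr_wpDl.
have : 0 <= c by exact: ltW.
lra.
Unshelve. all: by end_near. Qed.

(** The test function that is 0 below eps / 2 and 1 above eps separates the two
    indicators. *)
Lemma converges_tail I (F : set_system I) {FF : ProperFilter F}
    (lam_ : I -> probability R R) lam (eps c : R) : 0 < eps ->
  converges_on (T := R) (@test_fun R R) F lam_ lam ->
  (forall i, \int[lam_ i]_s ind (eps / 2 < `|s|) <= c) ->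
  \int[lam]_s ind (eps < `|s|) <= c.
Proof.
move=> eps0 cl tails.
pose f (s : R) := Num.min 1 (Num.max 0 (2 / eps * `|s| - 1)).
have f01 s : 0 <= f s <= 1 by rewrite le_min ler01 le_max lexx/= ge_min lexx.
have e20 : 0 < 2 / eps by rewrite divr_gt0.
have tf : test_fun f.
  apply: (@lipschitz_test _ _ _ (2 / eps)) => // x y.
  have : `|x| <= `|y| + `|x - y| by rewrite -{1}(subrK y x) addrC ler_normD.
  rewrite -(ler_pM2l e20) mulrDr => hxy.
  have hD : 0 <= 2 / eps * `|x - y| by rewrite mulr_ge0// ltW.
  have /andP[_ fx1] := f01 x.
  have fxA : f x <= Num.max 0 (2 / eps * `|x| - 1) by rewrite /f ge_min lexx orbT.
  rewrite -lerBlDr [leRHS]/f le_min le_max; apply/andP; split; first lra.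
  by move: fxA; case: (leP 0) => _ fxA; apply/orP; [right|left]; lra.
have bf := test_bmR tf.
apply: (@le_trans _ _ (\int[lam]_s f s)).
  apply: le_mean => // [|s]; first exact: bm_norm_gtR.
  have [es|se] := ltP eps `|s|; last by case/andP: (f01 s).
  rewrite /f le_min lexx le_max /=; apply/orP; right.
  suff : 2 <= 2 / eps * `|s| by rewrite /=; lra.
  by rewrite -mulrA ler_peMr// mulrC ler_pdivlMr// mul1r ltW.
apply: (cvgr_to_le (cl f tf)); apply: filterE => i; apply: le_trans (tails i).
apply: le_mean => // [|s]; first exact: bm_norm_gtR.
have [es|se] := ltP (eps / 2) `|s|; first by case/andP: (f01 s).
rewrite /f ge_min ge_max lexx/=; apply/orP; right.
by rewrite subr_le0 mulrAC ler_pdivrMr//; lra.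
Qed.

End nonnegative_laws.

Section generalized_powers.
Context (R : realType) (E : completeNormedModType R).
Hypothesis sepE : separable E.
Variable mu : probability (borel E) R.
Local Notation convolve := (convolve sepE).
Local Notation conv_pow := (conv_pow sepE).
Local Notation mix := (mix sepE mu).

(** For s < 0, s X and `|s| X have the same law if X and - X do. *)
Lemma mix_absl (lam : probability R R) : symmetric_law mu ->
  same_law (mix (absl lam)) (mix lam).
Proof.
move=> sym; apply: same_law_mean => f bf; rewrite !mean_mix//.
have bG := bm_scale sepE mu bf.
rewrite mean_image_law//; apply: eq_Rintegral => s _.
have [s0|s0] := leP 0 s; first by rewrite ger0_norm.
rewrite ltr0_norm//.
have mN1 : measurable_fun setT ((fun x => (-1) *: (x : E)) : borel E -> borel E).
  have h := measurableT_comp (measurable_borelZ sepE)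
    (@pair1_measurable _ _ R (borel E) (-1 : R)).
  exact h.
have h : same_law (image_law mu mN1) mu by exact: sym.
rewrite -(eq_law_mean _ h) mean_image_law; last exact: (bm_homothety sepE _ bf).
by apply: eq_Rintegral => x _; rewrite scalerA mulrN1 opprK.
Qed.

(** The definition of the generalized convolution distinguishes whether mu is
    symmetric, but its effect on mixtures does not. *)
Lemma is_gconv_mix (l1 l2 nu : probability R R) : is_gconv mu l1 l2 nu ->
  same_law (mix nu) (convolve (mix l1) (mix l2)).
Proof.
case=> l []; rewrite !(mixE sepE) -!(convE sepE) => hl nsym sym.
apply: same_law_sym; apply: same_law_trans hl _.
have [h|h] := pselect (symmetric_law mu); last first.
  by apply: mix_law; apply: same_law_sym; exact: nsym.
apply: same_law_trans (same_law_sym (mix_absl l h)) _.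
by apply: mix_law; apply: same_law_sym; exact: sym.
Qed.

Lemma gconv_pow_mix (l nu : probability R R) n : gconv_pow mu l n nu ->
  same_law (mix nu) (conv_pow (mix l) n).
Proof.
elim=> [{}nu nul|{}n nu1 nu' _ IH /is_gconv_mix h].
  by apply: same_law_trans (mix_law sepE mu nul) _; apply: same_law_sym; exact: conv_pow1.
apply: same_law_trans h _; rewrite -addn1.
apply: same_law_sym; apply: same_law_trans (conv_powD sepE _ _ _) _.
by apply: conv_law; [exact: same_law_sym|exact: conv_pow1].
Qed.

(** Weak stability applied n times, with an absolute value at the end if mu is
    symmetric. *)
Lemma mixing_power (l : probability R R) n : weakly_stable mu ->
  exists pi : probability R R, same_law (mix pi) (conv_pow (mix l) n) /\
    (symmetric_law mu -> nonneg pi).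
Proof.
move=> st; elim: n => [|n [pi [hpi _]]].
  exists \d_(0 : R); split; first exact: mix_dirac0.
  by move=> _; exact: nonneg_dirac0.
have [l' hl'] := st l pi; move: hl'; rewrite !(mixE sepE) -(convE sepE) => hl'.
have hl : same_law (mix l') (conv_pow (mix l) n.+1).
  apply: same_law_trans (same_law_sym hl') _.
  by apply: conv_law => //; exact: same_law_refl.
have [h|h] := pselect (symmetric_law mu); last by exists l'.
exists (absl l'); split; last by move=> _; exact: nonneg_absl.
exact: same_law_trans (mix_absl l' h) hl.
Qed.

End generalized_powers.

(** * The semigroup *)

Section semigroup.
Context (R : realType) (E : completeNormedModType R).
Hypothesis sepE : separable E.
Variable mu : probability (borel E) R.
Hypothesis mu_stable : weakly_stable mu.
Hypothesis mu_neq0 :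
  ~ same_law mu (\d_((0 : E) : borel E) : set (borel E) -> \bar R).
Variable lam : probability R R.
Hypothesis lam_id : weakly_infinitely_divisible mu lam.
Local Notation convolve := (convolve sepE).
Local Notation conv_pow := (conv_pow sepE).
Local Notation mix := (mix sepE mu).

Lemma nonneg_root : symmetric_law mu -> nonneg lam.
Proof.
move=> sym; have [l [/(_ sym) l1 hl]] := lam_id (ltn0Sn 0).
inversion hl as [nu lamE|k nu nu' hk]; last by inversion hk.
by rewrite /nonneg (eq_law_mean _ lamE); exact: nonneg_support.
Qed.

(** The index n stands for N = n + 1. The choices of the mixing measures of the
    powers 0 and n + 1 are imposed, so that Lam 0 and Lam 1 will be limits of
    constant families. *)
Lemma root_powers : exists (root : nat -> probability R R)
    (pi : nat -> nat -> probability R R),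
  [/\ forall n, same_law (mix lam) (conv_pow (mix (root n)) n.+1),
      forall n k, same_law (mix (pi n k)) (conv_pow (mix (root n)) k),
      symmetric_law mu -> forall n k, nonneg (pi n k),
      forall n, pi n 0 = \d_(0 : R) & forall n, pi n n.+1 = lam].
Proof.
have /choice[root rootP] : forall n, exists l, gconv_pow mu l n.+1 lam.
  by move=> n; have [l [_ hl]] := lam_id (ltn0Sn n); exists l.
have lamE n : same_law (mix lam) (conv_pow (mix (root n)) n.+1).
  exact: gconv_pow_mix.
have /choice[pi piP] : forall nk : nat * nat, exists p : probability R R,
    [/\ same_law (mix p) (conv_pow (mix (root nk.1)) nk.2),
        symmetric_law mu -> nonneg p,
        nk.2 = 0 -> p = \d_(0 : R) & nk.2 = nk.1.+1 -> p = lam].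
  move=> [n k] /=; have [->|k0] := eqVneq k 0%N.
    exists \d_(0 : R); split => //; first exact: mix_dirac0.
    by move=> _; exact: nonneg_dirac0.
  have [->|kn] := eqVneq k n.+1.
    by exists lam; split => //; exact: nonneg_root.
  have [p [pE p0]] := mixing_power sepE (root n) k mu_stable.
  by exists p; split => // /eqP; rewrite ?(negbTE k0) ?(negbTE kn).
exists root, (fun n k => pi (n, k)); split => // [n k|sym n k|n|n].
- by have [] := piP (n, k).
- by have [_ /(_ sym)] := piP (n, k).
- by have [_ _ /(_ erefl)] := piP (n, 0).
- by have [_ _ _ /(_ erefl)] := piP (n, n.+1).
Qed.

(** The tail condition is all that convergence to the Dirac mass at 0 requires,
    for continuous bounded functions that need not be uniformly continuous. *)
Lemma weak_cvg_dirac0 (Lam : R -> probability R R) :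
  (forall eps c : R, 0 < eps -> 0 < c ->
    \forall r \near 0^'+, \int[Lam r]_s ind (eps < `|s|) <= c) ->
  weakly_converges 0^'+ Lam (\d_(0 : R) : set R -> \bar R).
Proof.
move=> tails f cf bdf.
have bf : bounded_measurable f.
  split; first exact: continuous_measurable_fun.
  have [M [_ MP]] := bdf; exists (M + 1) => x.
  by apply: MP => //; rewrite ltrDl.
have mE (P : probability R R) : (\int[P]_x (f x)%:E)%E = (\int[P]_x f x)%:E.
  by rewrite /Rintegral fineK//; apply: integrable_fin_num => //; exact: bm_integrable.
rewrite mE mean_dirac// (_ : (fun i => _) = (fun i => (\int[Lam i]_x f x)%:E)).
  by apply: cvg_EFin; [exact: nearW|apply: mean_cvg_dirac0 => //; exact: cf].
by apply/funext => i; rewrite mE.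
Qed.

Let floor_mul (r : R) (n : nat) : nat := Num.truncn (r * n.+1%:R).

Let floor_mulD (r s : R) (n : nat) : 0 <= r -> 0 <= s ->
  exists2 e, (e <= 1)%N &
    floor_mul (r + s) n = (floor_mul r n + (floor_mul s n + e))%N.
Proof.
move=> r0 s0; rewrite /floor_mul mulrDl.
set x := r * _; set y := s * _.
have x0 : 0 <= x by rewrite mulr_ge0.
have y0 : 0 <= y by rewrite mulr_ge0.
have xy0 : 0 <= x + y by rewrite addr_ge0.
have /andP[x1 x2] := truncn_itv x0; have /andP[y1 y2] := truncn_itv y0.
have /andP[xy1 xy2] := truncn_itv xy0.
rewrite -natr1 in x2; rewrite -natr1 in y2.
set a := Num.truncn x in x1 x2 *; set b := Num.truncn y in y1 y2 *.
set c := Num.truncn (x + y) in xy1 xy2 *.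
have cle : (c < (a + b).+2)%N by rewrite -(ltr_nat R) -2!natr1 natrD; lra.
have lec : (a + b < c.+1)%N by rewrite -(ltr_nat R) natrD; lra.
exists (c - (a + b))%N; first by rewrite leq_subLR addn1.
by rewrite addnA subnKC.
Qed.

(** The limits for r = 0 and r = 1 are imposed, which is consistent since the
    corresponding families are constant. For the last property, smallness holds
    for pi n (floor_mul r n), uniformly in n, before the limit is taken. *)
Lemma semigroup_exists : exists Lam : R -> probability R R,
  [/\ Lam 0 = \d_(0 : R), Lam 1 = lam,
      symmetric_law mu -> forall r, nonneg (Lam r),
      forall r s, 0 <= r -> 0 <= s ->
        same_law (convolve (mix (Lam r)) (mix (Lam s))) (mix (Lam (r + s))) &
      forall eps c : R, 0 < eps -> 0 < c ->
        \forall r \near 0^'+, \int[Lam r]_s ind (eps < `|s|) <= c].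
Proof.
have [root [pi [lamE piE pi_sym pi0 pi1]]] := root_powers.
have [z [z0 p0]] := charged_ball sepE mu_neq0.
have z1 : 0 < `|z| by rewrite normr_gt0.
(* The law of the C (n + 1)-th convolution power does not depend on n: it is the
   C-th power of the mixture by lam. *)
have tight0 (C : nat) (e : R) : 0 < e -> e <= 4^-1 -> exists t : R, 0 <= t /\
    forall n k, (k <= C * n.+1)%N ->
      \int[conv_pow (mix (root n)) k]_x ind (t < `|x : E|) < e.
  move=> e0 e4; have cid : continuous (fun x : E => x) by move=> x; exact: cvg_id.
  have [t [t0 tP]] := tail_exists (conv_pow (mix lam) C) (measurable_borel_norm cid) e0.
  exists (14 * t); split; first by rewrite mulr_ge0// ltW.
  move=> n; apply: conv_pow_tight => //.
  rewrite (eq_law_mean _ (conv_powM sepE _ n.+1 C)).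
  by rewrite -(eq_law_mean _ (conv_pow_law sepE C (lamE n))).
have tight (C : nat) (e : R) : 0 < e -> exists M : R, forall n k,
    (k <= C * n.+1)%N -> \int[pi n k]_s ind (M < `|s|) < e.
  move=> e0; set p := \int[mu]_x ind (`|(x : E) - z| <= `|z| / 2) : R in p0.
  have [||t [t0 tP]] := tight0 C (Num.min 4^-1 (p * e)).
  - by rewrite lt_min invr_gt0 ltr0n/= mulr_gt0.
  - by rewrite ge_min lexx.
  exists (t / (`|z| / 2)) => n k kC.
  rewrite -(ltr_pM2l p0); apply: le_lt_trans (mix_tail sepE mu z0 _ _) _.
    by rewrite !divr_ge0.
  rewrite divfK; last by rewrite gt_eqF// divr_gt0.
  rewrite (eq_law_mean _ (piE n k)) (lt_le_trans (tP n k kC))//.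
  by rewrite ge_min lexx orbT.
have [U [UU ooU]] := ultraFilterLemma (eventually_filter : ProperFilter \oo).
have UP : ProperFilter U by exact: ultra_proper.
have /choice[Lam LamP] : forall r, exists L : probability R R,
    [/\ converges_on (T := R) (@test_fun R R) U (fun n => pi n (floor_mul r n)) L,
        symmetric_law mu -> nonneg L,
        r = 0 -> L = \d_(0 : R) & r = 1 -> L = lam].
  move=> r; have [->|r0] := eqVneq r 0.
    exists \d_(0 : R); split => //.
    - move=> f tf; rewrite (_ : (fun n => _) = fun=> \int[\d_(0 : R)]_x f x).
        exact: cvg_cst.
      by apply/funext => n; rewrite /floor_mul mul0r truncn0 pi0.
    - by move=> _; exact: nonneg_dirac0.
    - by move=> /esym/eqP; rewrite oner_eq0.
  have [->|r1] := eqVneq r 1.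
    exists lam; split => //.
    - move=> f tf; rewrite (_ : (fun n => _) = fun=> \int[lam]_x f x).
        exact: cvg_cst.
      by apply/funext => n; rewrite /floor_mul mul1r natrK pi1.
    - exact: nonneg_root.
    - by move=> /eqP; rewrite oner_eq0.
  have [L LP] : exists L : probability R R, converges_on (T := R)
      (@test_fun R R) U (fun n => pi n (floor_mul r n)) L.
    apply: tight_ultra_converges => // e e0.
    have [M MP] := tight (Num.truncn r).+1 e e0; exists M => n; apply: MP.
    rewrite /floor_mul truncn_le_nat.
    apply: (@le_lt_trans _ _ ((Num.truncn r).+1%:R * n.+1%:R)).
      by rewrite ler_wpM2r// ltW// truncnS_gt.
    by rewrite -natrM ltr_nat.
  have [sym|nsym] := pselect (symmetric_law mu); last first.
    by exists L; split => // /eqP; rewrite ?(negbTE r0) ?(negbTE r1).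
  (* the absolute value puts the limit on the half line *)
  exists (absl L); split => //; [|by move=> _; exact: nonneg_absl|..]; last 2 first.
    by move=> /eqP; rewrite (negbTE r0).
    by move=> /eqP; rewrite (negbTE r1).
  move=> f tf; have bf := test_bmR tf.
  have tfn : test_fun (fun s : R => f `|s|).
    have [uf f01] := tf; split => // e /uf[d d0 fd]; exists d => // x y xy.
    by apply: fd; exact: le_lt_trans (ler_dist_dist _ _) xy.
  rewrite mean_image_law// (_ : (fun n => _) =
    (fun n => \int[pi n (floor_mul r n)]_s f `|s|)); first exact: LP.
  apply/funext => n.
  by rewrite (eq_law_mean _ (absl_nonneg (pi_sym sym n (floor_mul r n)))) mean_image_law.
have [t [t0 tP]] := tight0 1%N 4^-1 ltac:(lra) (lexx _).
have root_tails eps c : 0 < eps -> 0 < c ->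
    \forall n \near U, \int[root n]_s ind (eps < `|s|) <= c.
  move=> eps0 c0; have [n0 n0P] := mixing_infinitesimal sepE z0 p0 t0 eps0 c0.
  apply: ooU; exists n0 => // n /= n0n; apply: n0P => j jn.
  by apply/ltW/tP; rewrite mul1n; lia.
have root_cvg : converges_on (T := borel E) (@test_fun R E) U
    (fun n => mix (root n)) (zero_law E).
  apply: (converges_on_law (P_ := fun n => mix (root n)) (P := mix \d_(0 : R))).
  - by move=> n; exact: same_law_refl.
  - exact: mix_dirac0.
  apply: converges_mix => f tf; have bf := test_bmR tf.
  rewrite mean_dirac//; apply: mean_cvg_dirac0 => //.
  by apply: (@unif_cont_continuous _ R^o); case: tf.
exists Lam; split.
- by have [_ _ /(_ erefl)] := LamP 0.
- by have [_ _ _ /(_ erefl)] := LamP 1.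
- by move=> sym r; have [_ /(_ sym)] := LamP r.
- move=> r s r0 s0.
  have /choice[e eP] : forall n, exists e, (e <= 1)%N /\
      floor_mul (r + s) n = (floor_mul r n + (floor_mul s n + e))%N.
    by move=> n; have [e] := floor_mulD n r0 s0; exists e.
  (* the additional factor has exponent 0 or 1 *)
  have e_cvg : converges_on (T := borel E) (@test_fun R E) U
      (fun n => conv_pow (mix (root n)) (e n)) (zero_law E).
    move=> f tf; have bf := test_bm tf.
    apply/cvgrPdist_lt => d d0.
    have /cvgrPdist_lt/(_ _ d0) := root_cvg f tf; apply: filterS => n.
    have [] := eP n; case: (e n) => [_ _ _|[|//] _ _]; first by rewrite subrr normr0.
    by rewrite (eq_law_mean _ (conv_pow1 sepE _)).
  have Lam_cvg q : converges_on (T := borel E) (@test_fun R E) U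
      (fun n => mix (pi n (floor_mul q n))) (mix (Lam q)).
    by apply: converges_mix; case: (LamP q).
  have prod_cvg := converges_convolve (sepE := sepE) (Lam_cvg r)
    (converges_convolve (sepE := sepE) (Lam_cvg s) e_cvg).
  have limitE : same_law (convolve (mix (Lam r)) (convolve (mix (Lam s)) (zero_law E)))
      (mix (Lam (r + s))).
    apply: (converges_unique _ (Lam_cvg (r + s))).
    apply: (converges_on_law _ _ (prod_cvg _ _)); last exact: same_law_refl.
    move=> n; have [_ rsE] := eP n.
    apply: same_law_sym; apply: same_law_trans (piE _ _) _; rewrite rsE.
    apply: same_law_trans (conv_powD _ _ _ _) _.
    apply: conv_law; first exact: same_law_sym (piE _ _).
    apply: same_law_trans (conv_powD _ _ _ _) _.
    by apply: conv_law; [exact: same_law_sym (piE _ _)|exact: same_law_refl].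
  apply: same_law_trans limitE.
  apply: conv_law; first exact: same_law_refl.
  by apply: same_law_sym; exact: conv0r.
- move=> eps c eps0 c0; have eps20 : 0 < eps / 2 by rewrite divr_gt0.
  (* For r < 1 / (n0 + 1), the first n0 powers of the mixture by
     pi n (floor_mul r n) are powers of the n-th root with exponent at most
     n + 1, which have controlled tails. *)
  have [n0 n0P] := mixing_infinitesimal sepE z0 p0 t0 eps20 c0.
  have n0V : 0 < n0.+1%:R^-1 :> R by rewrite invr_gt0.
  near=> r.
  have r0 : 0 < r by near: r; exact: nbhs_right_gt.
  have rn0 : r < n0.+1%:R^-1 by near: r; exact: nbhs_right_lt.
  have [Lam_cvg _ _ _] := LamP r; apply: (converges_tail eps0 Lam_cvg).
  move=> n; apply: n0P => j jn.
  rewrite (eq_law_mean _ (conv_pow_law sepE j (piE n (floor_mul r n)))).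
  rewrite -(eq_law_mean _ (conv_powM sepE _ _ j)); apply/ltW/tP; rewrite mul1n.
  rewrite -(@ler_nat R) natrM /floor_mul.
  have rn : 0 <= r * n.+1%:R by rewrite mulr_ge0// ltW.
  have /andP[h1 _] := truncn_itv rn.
  apply: (@le_trans _ _ (n0.+1%:R * (r * n.+1%:R))).
    by rewrite ler_pM// ler_nat; exact: leqW.
  rewrite mulrA ler_piMl// mulrC -ler_pdivlMr// div1r; exact: ltW.
Unshelve. all: by end_near. Qed.

End semigroup.

Theorem lemma2 (R : realType) (E : completeNormedModType R)
    (sepE : separable E)
    (mu : probability (borel E) R)
    (mu_stable : weakly_stable mu)
    (mu_neq0 : ~ same_law mu (\d_((0 : E) : borel E) : set (borel E) -> \bar R))
    (lam : probability R R)
    (lam_id : weakly_infinitely_divisible mu lam) :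
  exists Lam : R -> probability R R,
    [/\ same_law (Lam 0) (\d_(0 : R) : set R -> \bar R)
        /\ same_law (Lam 1) lam,
        forall r s : R, 0 <= r -> 0 <= s ->
          is_gconv mu (Lam r) (Lam s) (Lam (r + s))
      & weakly_converges 0^'+ Lam (\d_(0 : R) : set R -> \bar R)].
Proof.
have [Lam [Lam0 Lam1 Lam_sym LamD Lam_tails]] :=
  semigroup_exists sepE mu_stable mu_neq0 lam_id.
exists Lam; split.
- by rewrite Lam0 Lam1; split; exact: same_law_refl.
- move=> r s r0 s0; exists (Lam (r + s)); split => [|_|sym].
  + by rewrite !(mixE sepE) -(convE sepE); exact: LamD.
  + exact: same_law_refl.
  + exact: (absl_nonneg (Lam_sym sym (r + s))).
- exact: weak_cvg_dirac0.
Qed.
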